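(* Assume that $Y_V$ satisfies the spectral density condition and is purely non-deterministic, and let $G_{OG}=(V,E_{OG})$ be the orthogonality graph for $Y_V$. Then $Y_V$ satisfies the global AMP Markov property with respect to $G_{OG}$, i.e., for all disjoint subsets $A,B,C\subseteq V$: if $A$ and $B$ are $m$-separated given $C$ in $G_{OG}$, then $\mathcal{L}_{Y_A}\perp\mathcal{L}_{Y_B}\mid\mathcal{L}_{Y_C}$.
   Context: $V=\{1,\ldots,k\}$ and $Y_V=(Y_V(t))_{t\in\mathbb{R}}$ is a $k$-dimensional weakly stationary process with expectation zero, continuous in mean square, with components $Y_v$ and subprocesses $Y_A=(Y_a)_{a\in A}$. $L^2$ is the Hilbert space of square-integrable complex random variables with $\langle X,Y\rangle=\mathbb{E}[X\overline{Y}]$; $P_{\mathcal L}$ is orthogonal projection onto a closed subspace. $\mathcal{L}_{Y_A}(s,t)$ is the closed linear span of $\{Y_a(u):a\in A,u\in[s,t]\cap\mathbb{R}\}$, $\mathcal{L}_{Y_A}(t)=\mathcal{L}_{Y_A}(-\infty,t)$ and $\mathcal{L}_{Y_A}=\mathcal{L}_{Y_A}(-\infty,\infty)$ (all $\{0\}$ if $A=\emptyset$). $\mathcal{L}_1\perp\mathcal{L}_2\mid\mathcal{L}_3$ means $\mathbb{E}[(X-P_{\mathcal{L}_3}X)\overline{(Y-P_{\mathcal{L}_3}Y)}]=0$ for all $X\in\mathcal{L}_1,Y\in\mathcal{L}_2$. For $A,B\subseteq S\subseteq V$, $A\cap B=\emptyset$: $Y_A\not\to Y_B\mid Y_S$ means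 $\mathcal{L}_{Y_B}(t,t+1)\perp\mathcal{L}_{Y_A}(t)\mid\mathcal{L}_{Y_{S\setminus A}}(t)$ for all $t\in\mathbb{R}$; $Y_A\not\sim Y_B\mid Y_S$ means $\mathcal{L}_{Y_A}(t,t+1)\perp\mathcal{L}_{Y_B}(t,t+1)\mid\mathcal{L}_{Y_S}(t)$ for all $t\in\mathbb{R}$. Spectral density condition: $Y_V$ has a spectral density matrix $f_{Y_VY_V}(\cdot)>0$ (positive definite) and there is $0<\varepsilon<1$ such that $(1-\varepsilon)I_\alpha-f_{Y_AY_A}(\lambda)^{-1/2}f_{Y_AY_B}(\lambda)f_{Y_BY_B}(\lambda)^{-1}f_{Y_BY_A}(\lambda)f_{Y_AY_A}(\lambda)^{-1/2}$ is positive semi-definite for almost all $\lambda\in\mathbb{R}$ and all disjoint $A,B\subseteq V$, $\#A=\alpha$ ($f_{Y_AY_B}$ is the $A\times B$ block of $f_{Y_VY_V}$). Purely non-deterministic: $\bigcap_{t\in\mathbb{R}}\mathcal{L}_{Y_V}(t)=\{0\}$. Orthogonality graph $G_{OG}=(V,E_{OG})$: mixed graph with vertex set $V$ where, for $a\neq b$, $a\to b\notin E_{OG}$ iff $Y_a\not\to Y_b\mid Y_V$, and the undirected (dashed) edge $a\,\text{-}\,\text{-}\,b\notin E_{OG}$ iff $Y_a\not\sim Y_b\mid Y_V$. Paths: a path between vertices $a$ and $b$ is a sequence $\langle e_1,\ldots,e_n\rangle$ of edges such that $e_i$ is an edge between $v_{i-1}$ and $v_i$ for some sequence of (not necessarily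 distinct) vertices $a=v_0,v_1,\ldots,v_n=b$; $v_1,\ldots,v_{n-1}$ are the intermediate vertices. An intermediate vertex $c$ is a collider on the path if the edges preceding and succeeding it both have an arrowhead or a dashed tail at $c$ (i.e. $\to c\leftarrow$, $\to c\,\text{-}\,\text{-}$, $\text{-}\,\text{-}\,c\leftarrow$, $\text{-}\,\text{-}\,c\,\text{-}\,\text{-}$), otherwise it is a non-collider. A path is $m$-connecting given $C$ if every non-collider on it is not in $C$ and every collider on it is in $C$; otherwise it is $m$-blocked given $C$. Sets $A$ and $B$ are $m$-separated given $C$ if for all $a\in A$, $b\in B$ every path between $a$ and $b$ is $m$-blocked given $C$. *)

(* Defs.v *)
From HB Require Import structures.
From mathcomp Require Import all_boot all_order all_algebra.
From mathcomp Require Import complex.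
From mathcomp Require Import all_classical all_reals all_analysis.
Set Implicit Arguments.
Unset Strict Implicit.
Unset Printing Implicit Defensive.
Import Order.TTheory GRing.Theory Num.Theory.
Import numFieldNormedType.Exports.
Local Open Scope classical_set_scope.
Local Open Scope ring_scope.
Local Open Scope sesquilinear_scope.

Section Matrices.
Context {C : numClosedFieldType}.

Definition posdefmx n (M : 'M[C]_n) : Prop :=
  M \is hermsymmx /\
  forall v : 'rV[C]_n, v != 0 -> 0 < (v *m M *m v ^t*) 0 0.

Definition possemidefmx n (M : 'M[C]_n) : Prop :=
  M \is hermsymmx /\
  forall v : 'rV[C]_n, 0 <= (v *m M *m v ^t*) 0 0.

Definition blockmx n (A B : {set 'I_n}) (M : 'M[C]_n) : 'M[C]_(#|A|, #|B|) :=
  \matrix_(i, j) M (enum_val i) (enum_val j).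

(* M^(-1/2) for positive definite M, by functional calculus on the spectral
   decomposition of M; see [invsqrtmx_posdef] and [invsqrtmxK]. *)
Definition invsqrtmx n (M : 'M[C]_n) : 'M[C]_n :=
  invmx (spectralmx M)
  *m diag_mx (map_mx (fun x => (sqrtC x)^-1) (spectral_diag M))
  *m spectralmx M.

Lemma unitary_diag_form n (U : 'M[C]_n) (e v : 'rV[C]_n) :
  U \is unitarymx ->
  (v *m (invmx U *m diag_mx e *m U) *m v ^t*) 0 0
  = \sum_j e 0 j * `|(v *m U ^t*) 0 j| ^+ 2.
Proof.
move=> Uy; rewrite (invmx_unitary Uy) !mulmxA -[_ *m U *m _]mulmxA.
have -> : U *m v ^t* = (v *m U ^t*) ^t*.
  by rewrite trmx_mul map_mxM trmxCK.
rewrite [LHS]mxE; apply: eq_bigr => j _.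
rewrite mul_mx_diag; set w := v *m U ^t*.
by rewrite !mxE normCK mulrAC mulrC.
Qed.

Lemma unitary_diag_posdef n (U : 'M[C]_n) (e : 'rV[C]_n) :
  U \is unitarymx -> (forall j, 0 < e 0 j) ->
  posdefmx (invmx U *m diag_mx e *m U).
Proof.
move=> Uy e0; split.
  apply/is_hermitianmxP; rewrite expr0 scale1r (invmx_unitary Uy).
  rewrite !trmx_mul !map_mxM trmxCK mulmxA tr_diag_mx map_diag_mx.
  congr (_ *m diag_mx _ *m _); apply/rowP => j; rewrite mxE.
  by apply/esym/geC0_conj/ltW.
move=> v v0; rewrite unitary_diag_form //.
have w0 : v *m U ^t* != 0.
  apply: contra v0 => /eqP w0; apply/eqP.
  by rewrite -[v](mulmxKV (unitarymx_unit Uy)) (invmx_unitary Uy) w0 mul0mx.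
have [j wj] : exists j, (v *m U ^t*) 0 j != 0.
  by apply/existsP; apply: contraNT w0; rewrite negb_exists => /forallP h;
     apply/eqP/rowP => j; rewrite [RHS]mxE; apply/eqP; rewrite -[_ == _]negbK h.
rewrite (bigD1 j) //= ltr_wpDr //.
  by apply: sumr_ge0 => l _; rewrite mulr_ge0 ?exprn_ge0 // ltW.
by rewrite mulr_gt0 // exprn_gt0 // normr_gt0.
Qed.

Lemma posdefmx_spectral_diag n (M : 'M[C]_n) (i : 'I_n) :
  posdefmx M -> 0 < spectral_diag M 0 i.
Proof.
move=> [Mh Mp]; have Uy := spectral_unitarymx M.
have v0 : row i (spectralmx M) != 0.
  apply/eqP => r0; have := row_mul i (spectralmx M) (invmx (spectralmx M)).
  rewrite mulmxV ?spectral_unit // r0 mul0mx => /rowP/(_ i)/eqP.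
  by rewrite !mxE eqxx oner_eq0.
have := Mp _ v0.
rewrite {2}(orthomx_spectralP (hermitian_normalmx Mh)) unitary_diag_form //.
rewrite -row_mul (unitarymxP Uy) (bigD1 i) //= big1 => [|j ji].
  by rewrite addr0 !mxE eqxx normr1 expr1n mulr1.
by rewrite !mxE eq_sym (negPf ji) normr0 expr0n mulr0.
Qed.

Lemma invsqrtmx_posdef n (M : 'M[C]_n) : posdefmx M -> posdefmx (invsqrtmx M).
Proof.
move=> Mp; apply: unitary_diag_posdef => [|j]; first exact: spectral_unitarymx.
by rewrite mxE invr_gt0 sqrtC_gt0 posdefmx_spectral_diag.
Qed.

Lemma invsqrtmxK n (M : 'M[C]_n) :
  posdefmx M -> invsqrtmx M *m invsqrtmx M *m M = 1%:M.
Proof.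
move=> Mp; have U1 := spectral_unit M.
rewrite {3}(orthomx_spectralP (hermitian_normalmx Mp.1)) /invsqrtmx.
rewrite !mulmxA !(mulmxK U1) -2![invmx _ *m _ *m _]mulmxA !mulmx_diag.
set D := diag_mx _; suff -> : D = 1%:M by rewrite mulmx1 mulVmx.
apply/matrixP => a b; rewrite !mxE -invfM -expr2 sqrtCK.
by rewrite mulVf // gt_eqF // posdefmx_spectral_diag.
Qed.
End Matrices.

(* Random variables are functions T -> R[i]; equality in L^2 is equality
   almost surely, and all the subspaces below are closed under it. *)
Section L2.
Context {R : realType}.

Definition cintegrable d (T : measurableType d)
    (mu : {measure set T -> \bar R}) (f : T -> R[i]) : Prop :=
  mu.-integrable setT (EFin \o (fun x => complex.Re (f x))) /\
  mu.-integrable setT (EFin \o (fun x => complex.Im (f x))).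

Definition cintegral d (T : measurableType d)
    (mu : {measure set T -> \bar R}) (f : T -> R[i]) : R[i] :=
  Complex (\int[mu]_x complex.Re (f x)) (\int[mu]_x complex.Im (f x)).

Context d (T : measurableType d) (P : probability T R).
Implicit Types (X Y Z : T -> R[i]) (S L : set (T -> R[i])).

Definition sqint : set (T -> R[i]) :=
  [set X | (fun w => complex.Re (X w)) \in Lfun P 2%:E /\
           (fun w => complex.Im (X w)) \in Lfun P 2%:E].

Definition inner X Y : R[i] := cintegral P (fun w => X w * (Y w)^*).

Definition L2dist X Y : R :=
  Num.sqrt (complex.Re (inner (X \- Y) (X \- Y))).

Definition lspan S : set (T -> R[i]) :=
  [set X | exists (n : nat) (c : 'I_n -> R[i]) (Z : 'I_n -> T -> R[i]),
     (forall i, S (Z i)) /\ X = (fun w => \sum_(i < n) c i * Z i w)].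

Definition closed_lspan S : set (T -> R[i]) :=
  [set X | sqint X /\
     forall e : R, 0 < e -> exists2 Z, lspan S Z & L2dist X Z < e].

Definition zero_space : set (T -> R[i]) :=
  [set X | sqint X /\ {ae P, forall w, X w = 0}].

Definition is_proj L X Z : Prop :=
  L Z /\ forall W, L W -> inner (X \- Z) W = 0.

(* A representative of the orthogonal projection of X on L. *)
Definition proj L X : T -> R[i] := xget (fun=> 0) [set Z | is_proj L X Z].

Definition cond_orth (L1 L2 L3 : set (T -> R[i])) : Prop :=
  forall X Y, L1 X -> L2 Y -> inner (X \- proj L3 X) (Y \- proj L3 Y) = 0.
End L2.

(* The directed and the dashed edges are independent of one another: two
   vertices may be joined by several edges. *)
Record mixed_graph (V : Type) := MixedGraph {
  directed : V -> V -> Prop;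
  dashed : V -> V -> Prop }.

(* The direction in which a path traverses an edge. *)
Inductive edge_kind := Forward | Backward | Dashed.

Section MSeparation.
Context {V : finType} (G : mixed_graph V).

Definition is_edge (e : edge_kind) (u v : V) : Prop :=
  match e with
  | Forward => directed G u v
  | Backward => directed G v u
  | Dashed => dashed G u v
  end.

(* A path from a is encoded by its edges e_i, each with its end vertex v_i:
   [:: (e_1, v_1); ...; (e_n, v_n)]. *)
Fixpoint is_path (a : V) (p : seq (edge_kind * V)) : Prop :=
  match p with
  | [::] => True
  | (e, v) :: p' => is_edge e a v /\ is_path v p'
  end.

Definition path_between (a b : V) (p : seq (edge_kind * V)) : Prop :=
  is_path a p /\ last a (map snd p) = b.

(* Whether a vertex entered through e1 and left through e2 is a collider. *)
Definition collider (e1 e2 : edge_kind) : bool :=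
  match e1, e2 with
  | (Forward | Dashed), (Backward | Dashed) => true
  | _, _ => false
  end.

Fixpoint m_connecting (C : {set V}) (p : seq (edge_kind * V)) : Prop :=
  match p with
  | (e1, v) :: ((e2, _) :: _) as p' =>
      (if collider e1 e2 then v \in C else v \notin C) /\ m_connecting C p'
  | _ => True
  end.

Definition m_separated (A B C : {set V}) : Prop :=
  forall a b p, a \in A -> b \in B -> path_between a b p -> ~ m_connecting C p.
End MSeparation.

Section Process.
Context {R : realType} d (T : measurableType d) (P : probability T R).
Context (k : nat) (Y : 'I_k -> R -> T -> R[i]).
Implicit Types (A B S : {set 'I_k}).

Definition weakly_stationary : Prop :=
  [/\ forall a t, sqint P (Y a t),
      forall a s t, cintegral P (Y a s) = cintegral P (Y a t) &
      forall a b s t h,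
        inner P (Y a (s + h)) (Y b (t + h)) = inner P (Y a s) (Y b t)].

Definition mean_zero : Prop := forall a t, cintegral P (Y a t) = 0.

Definition ms_continuous : Prop :=
  forall a t, L2dist P (Y a s) (Y a t) @[s --> t] --> (0 : R).

Definition lin_space A (s t : \bar R) : set (T -> R[i]) :=
  closed_lspan P
    [set X | exists a u, [/\ a \in A, (s <= u%:E <= t)%E & X = Y a u]].

Definition purely_nondeterministic : Prop :=
  \bigcap_(t in [set: R]) lin_space [set: 'I_k]%SET -oo%E t%:E = zero_space P.

(* Normalization: E[Y_a(t) Y_b(0)^*] = \int e^(i l t) f_ab(l) dl. *)
Definition is_spectral_density (f : R -> 'M[R[i]]_k) : Prop :=
  forall a b, cintegrable lebesgue_measure (fun l => f l a b) /\
    forall t, inner P (Y a t) (Y b 0) =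
      cintegral lebesgue_measure
        (fun l => Complex (cos (l * t)) (sin (l * t)) * f l a b).

(* The density is only determined almost everywhere, so asking for a version
   that is positive definite at every l is no restriction. *)
Definition spectral_density_condition : Prop :=
  exists f : R -> 'M[R[i]]_k,
  [/\ is_spectral_density f, forall l, posdefmx (f l) &
   exists eps : R, 0 < eps < 1 /\
   forall A B, [disjoint A & B]%B -> {ae lebesgue_measure, forall l : R,
     let fAA := blockmx A A (f l) in
     let fAB := blockmx A B (f l) in
     let fBB := blockmx B B (f l) in
     let fBA := blockmx B A (f l) in
     possemidefmx
       ((Complex (1 - eps) 0)%:M
        - invsqrtmx fAA *m fAB *m invmx fBB *m fBA *m invsqrtmx fAA)}].

(* Y_A -/-> Y_B | Y_S *)
Definition noncausal A B S : Prop :=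
  forall t : R, cond_orth P (lin_space B t%:E (t + 1)%:E)
                            (lin_space A -oo%E t%:E)
                            (lin_space (S :\: A)%SET -oo%E t%:E).

(* Y_A -/~ Y_B | Y_S *)
Definition uncorrelated A B S : Prop :=
  forall t : R, cond_orth P (lin_space A t%:E (t + 1)%:E)
                            (lin_space B t%:E (t + 1)%:E)
                            (lin_space S -oo%E t%:E).

Definition orthogonality_graph : mixed_graph 'I_k := MixedGraph
  (fun a b => a != b /\ ~ noncausal [set a]%SET [set b]%SET [set: 'I_k]%SET)
  (fun a b => a != b /\ ~ uncorrelated [set a]%SET [set b]%SET [set: 'I_k]%SET).

Definition global_AMP_Markov (G : mixed_graph 'I_k) : Prop :=
  forall A B C : {set 'I_k},
    [disjoint A & B]%B -> [disjoint A & C]%B -> [disjoint B & C]%B ->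
    m_separated G A B C ->
    cond_orth P (lin_space A -oo%E +oo%E) (lin_space B -oo%E +oo%E)
                (lin_space C -oo%E +oo%E).
End Process.

(* Main.v *)
Require Import Defs.
From HB Require Import structures.
From mathcomp Require Import all_boot all_order all_algebra.
From mathcomp Require Import complex.
From mathcomp Require Import all_classical all_reals all_analysis.
From mathcomp Require Import measurable_realfun ring lra.
Set Implicit Arguments.
Unset Strict Implicit.
Unset Printing Implicit Defensive.
Import Order.TTheory GRing.Theory Num.Theory.
Import numFieldNormedType.Exports.
Local Open Scope classical_set_scope.
Local Open Scope ring_scope.
Local Open Scope sesquilinear_scope.

(** The argument is a Hilbert space version of the factorization of a Gaussian
    likelihood along time.

    The spectral density condition says that, in the spectral domain, the
    component indexed by a set [A] of vertices stays at a uniformly positive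
    angle from the component indexed by the complement: completing the square
    in the quadratic form of the density leaves a Schur complement bounded
    below ([schur_bound], [space_angle]).  Hence every closed span splits
    as a topological direct sum over vertices ([space_split]).  This has two
    consequences.  The absence of the directed edges into a vertex from all
    vertices outside a set [W] makes the predictor of that vertex from the whole
    past a function of the past of [W] ([predictor_parents]).  And a variable
    known from the past of [C] together with the arbitrarily remote past of
    everything is known from the past of [C], because its component off [C]
    lies in the remote past, which is null ([remote_past]).

    On the side of the graph, m-separation of [A] and [B] given [C] lets one cut
    the ancestors of [A], [B] and [C] into two parts [M] and [N], containing
    [A] and [B], with no dashed edge between them, and such that the parents of
    [M] avoid the vertices of [N] off [C], and conversely: [M] consists of the
    vertices off [C] that an m-connecting path from [A] can reach, together with
    the vertices of [C] that such a path can enter by an arrowhead or a dashed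
    edge ([sideM], [reach_open]).

    Start at a time [s] and condition on the past of everything up to [s].  Over
    each unit of time, [M] is its predictor from [A] and [C] plus an innovation,
    [N] is its predictor from [B] and [C] plus an innovation, and the two
    innovations are orthogonal; so the orthogonality of [A] and [B] up to time
    [t], given [C] up to [t], propagates from [t] to [t + 1]
    ([separated_until_step]).  Letting [s] tend to minus infinity and then [t]
    to plus infinity, and using that projections converge along monotone
    sequences of closed subspaces, gives the theorem ([separated_always]).

    Projections exist because square-integrable functions are complete
    ([riesz_fischer], [oproj_exists]). *)

(** * Orthogonal projections in a complete semi-inner product space *)

Lemma Re_conj (R : realType) (z : R[i]) : complex.Re z^* = complex.Re z.
Proof. by case: z. Qed.

Lemma ReD (R : realType) (z w : R[i]) :
  complex.Re (z + w) = complex.Re z + complex.Re w.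
Proof. by case: z w => [? ?] [? ?]. Qed.

Lemma ReN (R : realType) (z : R[i]) : complex.Re (- z) = - complex.Re z.
Proof. by case: z. Qed.

Lemma sqr_conj_Re (R : realType) (z : R[i]) :
  z * z^* = (complex.Re z ^+ 2 + complex.Im z ^+ 2)%:C%C.
Proof.
by case: z => a b; apply/eqP; rewrite eq_complex /=; apply/andP; split; apply/eqP; ring.
Qed.

Lemma ReZ (R : realType) (a : R) (z : R[i]) :
  complex.Re (a%:C%C * z) = a * complex.Re z.
Proof. by case: z => b c /=; rewrite mul0r subr0. Qed.

Lemma csq_eq0 (R : realType) (z : R[i]) :
  complex.Re z ^+ 2 + complex.Im z ^+ 2 <= 0 -> z = 0.
Proof.
case: z => a b /= h; have := sqr_ge0 a; have := sqr_ge0 b => b0 a0.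
apply/eqP; rewrite eq_complex /= -[a == 0]sqrf_eq0 -[b == 0]sqrf_eq0.
by rewrite !eq_le a0 b0 !andbT; apply/andP; split; lra.
Qed.

Lemma conj_real (R : realType) (t : R) : (t%:C%C : R[i])^* = t%:C%C.
Proof. by apply/eqP; rewrite eq_complex /= oppr0 !eqxx. Qed.

(** The form may be degenerate: random variables are functions here, and almost
    surely equal ones are at distance zero without being equal.  Completeness
    is accordingly the existence of some limit. *)
Record hilbert_form (R : realType) (H : lmodType R[i]) := HilbertForm {
  form :> H -> H -> R[i];
  formDl : forall x y z, form (x + y) z = form x z + form y z;
  formZl : forall c x z, form (c *: x) z = c * form x z;
  formC : forall x y, form y x = (form x y)^*;
  form_ge0 : forall x, 0 <= complex.Re (form x x);
  form_complete : forall u : nat -> H,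
    (forall e : R, 0 < e -> exists n, forall m, (n <= m)%N ->
       complex.Re (form (u m - u n) (u m - u n)) < e) ->
    exists l, forall e : R, 0 < e -> exists n, forall m, (n <= m)%N ->
       complex.Re (form (u m - l) (u m - l)) < e }.

Section Hilbert.
Context {R : realType} {H : lmodType R[i]} (dot : hilbert_form H).
Implicit Types (x y z p q : H) (S K L : set H).

Definition nsq x : R := complex.Re (dot x x).

Lemma dot0l x : dot 0 x = 0.
Proof. by rewrite -(scale0r (0 : H)) formZl mul0r. Qed.
Lemma dotNl x y : dot (- x) y = - dot x y.
Proof. by rewrite -scaleN1r formZl mulN1r. Qed.
Lemma dotBl x y z : dot (x - y) z = dot x z - dot y z.
Proof. by rewrite formDl dotNl. Qed.
Lemma dotDr x y z : dot x (y + z) = dot x y + dot x z.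
Proof. by rewrite formC formDl rmorphD /= -!formC. Qed.
Lemma dotZr c x y : dot x (c *: y) = c^* * dot x y.
Proof. by rewrite formC formZl rmorphM /= -!formC. Qed.
Lemma dot0r x : dot x 0 = 0.
Proof. by rewrite formC dot0l rmorph0. Qed.
Lemma dotNr x y : dot x (- y) = - dot x y.
Proof. by rewrite formC dotNl rmorphN /= -formC. Qed.
Lemma dotBr x y z : dot x (y - z) = dot x y - dot x z.
Proof. by rewrite dotDr dotNr. Qed.
Lemma dot_eq0C x y : dot x y = 0 -> dot y x = 0.
Proof. by move=> xy; rewrite formC xy rmorph0. Qed.

Lemma nsq_ge0 x : 0 <= nsq x. Proof. exact: form_ge0. Qed.
Lemma nsq0 : nsq 0 = 0. Proof. by rewrite /nsq dot0l. Qed.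
Lemma nsqN x : nsq (- x) = nsq x.
Proof. by rewrite /nsq dotNl dotNr opprK. Qed.
Lemma nsqBC x y : nsq (x - y) = nsq (y - x).
Proof. by rewrite -nsqN opprB. Qed.
Lemma nsqD x y : nsq (x + y) = nsq x + nsq y + complex.Re (dot x y) *+ 2.
Proof.
rewrite /nsq formDl !dotDr !ReD (formC dot x y) Re_conj; ring.
Qed.
Lemma nsqZ c x :
  nsq (c *: x) = (complex.Re c ^+ 2 + complex.Im c ^+ 2) * nsq x.
Proof. by rewrite /nsq formZl dotZr mulrA sqr_conj_Re ReZ. Qed.

Lemma parallelogram x y :
  nsq (x + y) + nsq (x - y) = nsq x *+ 2 + nsq y *+ 2.
Proof. by rewrite !nsqD nsqN dotNr ReN; ring. Qed.

(** The sharp form of the next bound, for limits in which the constant in front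
    of [nsq x] has to tend to one. *)
Lemma nsqD_le_weighted (t : R) x y : 0 < t ->
  nsq (x + y) <= (1 + t) * nsq x + (1 + t^-1) * nsq y.
Proof.
move=> t0; have := nsq_ge0 (t%:C%C *: x - y).
rewrite !nsqD nsqN nsqZ dotNr formZl ReN ReZ /= expr0n addr0 => h.
rewrite -(@ler_pM2l _ t) //; set r := complex.Re _ in h *.
have -> : t * ((1 + t) * nsq x + (1 + t^-1) * nsq y)
  = t * nsq x + t ^+ 2 * nsq x + t * nsq y + nsq y by field; lra.
by move: h; clearbody r; lra.
Qed.

Lemma nsqD_le x y : nsq (x + y) <= nsq x *+ 2 + nsq y *+ 2.
Proof. by rewrite -parallelogram lerDl nsq_ge0. Qed.

Lemma pythagoras x y : dot x y = 0 -> nsq (x + y) = nsq x + nsq y.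
Proof. by rewrite nsqD => ->; rewrite mul0rn addr0. Qed.

(** The first-order condition for a minimum of the distance to a line: real
    multiples of [w] give the real part, imaginary multiples the imaginary
    one. *)
Lemma dot_eq0_min x w :
  (forall c : R[i], nsq x <= nsq (x - c *: w)) -> dot x w = 0.
Proof.
have re y : (forall t : R, nsq x <= nsq (x - t%:C%C *: y)) ->
    complex.Re (dot x y) = 0.
  move=> h; set b := complex.Re _.
  have {}h t : 0 <= t ^+ 2 * nsq y - t * b *+ 2.
    have := h t; rewrite nsqD nsqN nsqZ dotNr dotZr ReN.
    rewrite conj_real ReZ -/b /=; lra.
  (* The exact minimizer would be [b / nsq y], but [y] may be null. *)
  have := h (b / (nsq y + 1)); set N := nsq y => hb.
  have N0 : 0 <= N := nsq_ge0 y.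
  have : 0 <= (N + 1) ^+ 2 * ((b / (N + 1)) ^+ 2 * N - b / (N + 1) * b *+ 2).
    by rewrite mulr_ge0 // sqr_ge0.
  have -> : (N + 1) ^+ 2 * ((b / (N + 1)) ^+ 2 * N - b / (N + 1) * b *+ 2)
      = - (b ^+ 2 * (N + 2)) by field; lra.
  rewrite oppr_ge0 => le0; apply/eqP; rewrite -sqrf_eq0 eq_le sqr_ge0 andbT.
  by rewrite -(@ler_pM2r _ (N + 2)) ?mul0r //; lra.
move=> h; have h1 := re w (fun t => h t%:C%C).
have /re : forall t : R, nsq x <= nsq (x - t%:C%C *: ('i%C *: w)).
  by move=> t; rewrite scalerA; exact: h.
rewrite dotZr => h2; apply/eqP; rewrite eq_complex h1 eqxx /=.
by move: h2; case: (dot x w) => a b /=; rewrite !mul0r sub0r mulN1r opprK => ->.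
Qed.

Lemma cauchy_schwarz x y :
  complex.Re (dot x y) ^+ 2 + complex.Im (dot x y) ^+ 2 <= nsq x * nsq y.
Proof.
have re z : complex.Re (dot z y) ^+ 2 <= nsq z * nsq y.
  (* [s] keeps the denominator positive when [y] is null. *)
  set b := complex.Re _; apply/ler_addgt0Pr => e e0.
  have N0 := nsq_ge0 y; have M0 := nsq_ge0 z.
  pose s := e / (nsq z + 1); have s0 : 0 < s by rewrite divr_gt0 //; lra.
  suff : b ^+ 2 <= nsq z * (nsq y + s).
    move=> /le_trans; apply; rewrite mulrDr lerD2l /s mulrCA ger_pMr //.
    by rewrite ler_pdivrMr ?mul1r; lra.
  have := nsq_ge0 (z - (b / (nsq y + s))%:C%C *: y).
  rewrite nsqD nsqN nsqZ dotNr dotZr ReN.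
  rewrite conj_real ReZ -/b /= => h.
  have : 0 <= (nsq y + s) ^+ 2 * (nsq z + (b / (nsq y + s)) ^+ 2 * nsq y
      - b / (nsq y + s) * b *+ 2).
    rewrite mulr_ge0 ?sqr_ge0 //; apply: le_trans h _; rewrite le_eqVlt.
    by apply/orP; left; apply/eqP; ring.
  have -> : (nsq y + s) ^+ 2 * (nsq z + (b / (nsq y + s)) ^+ 2 * nsq y
      - b / (nsq y + s) * b *+ 2)
    = (nsq y + s) * (nsq z * (nsq y + s) - b ^+ 2) - s * b ^+ 2.
    by field; lra.
  move=> {}h; have {h} : 0 <= (nsq y + s) * (nsq z * (nsq y + s) - b ^+ 2).
    by apply: le_trans h _; rewrite gerBl mulr_ge0 ?sqr_ge0 // ltW.
  by rewrite pmulr_rge0 ?subr_ge0 //; lra.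
(* Rotating [x] makes the product real. *)
have := re ((dot x y)^* *: x); rewrite formZl mulrC sqr_conj_Re nsqZ /=.
have -> : complex.Im (dot x y)^* = - complex.Im (dot x y) by case: (dot x y).
rewrite Re_conj sqrrN; set m := _ + _ => h.
have m0 : 0 <= m by rewrite addr_ge0 ?sqr_ge0.
move: m0; rewrite le_eqVlt => /predU1P[<-|m0].
  by rewrite mulr_ge0 ?nsq_ge0.
by move: h; rewrite expr2 -mulrA ler_pM2l.
Qed.

Lemma dot_eq0_limit x y :
  (forall e : R, 0 < e -> exists2 z, dot z y = 0 & nsq (x - z) < e) ->
  dot x y = 0.
Proof.
move=> h; set d := dot x y.
apply: csq_eq0; apply/ler_addgt0Pr => e e0; rewrite add0r.
have N0 := nsq_ge0 y.
have [|z zy xz] := h (e / (nsq y + 1)); first by rewrite divr_gt0 //; lra.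
have -> : d = dot (x - z) y by rewrite dotBl zy subr0.
apply: le_trans (cauchy_schwarz _ _) _.
apply: le_trans (ler_wpM2r N0 (ltW xz)) _.
rewrite mulrAC -mulrA ger_pMr // ler_pdivrMr ?mul1r; lra.
Qed.

Lemma nsq_eq0_dot x y : nsq x = 0 -> dot x y = 0.
Proof.
by move=> x0; apply: csq_eq0; rewrite (le_trans (cauchy_schwarz _ _)) // x0 mul0r.
Qed.

Record closed_subspace K : Prop := ClosedSubspace {
  csub0 : K 0;
  csubD : forall x y, K x -> K y -> K (x + y);
  csubZ : forall c x, K x -> K (c *: x);
  csub_lim : forall x,
    (forall e : R, 0 < e -> exists2 z, K z & nsq (x - z) < e) -> K x }.

Lemma csubB K x y : closed_subspace K -> K x -> K y -> K (x - y).
Proof.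
by move=> cK Kx Ky; apply: csubD => //; rewrite -scaleN1r; apply: csubZ.
Qed.

Lemma csub_null K x y : closed_subspace K -> K y -> nsq (x - y) = 0 -> K x.
Proof. by move=> cK Ky xy; apply: (csub_lim cK) => e e0; exists y; rewrite ?xy. Qed.

Lemma closed_orthogonal y : closed_subspace [set x | dot x y = 0].
Proof.
split=> /= [|x z xy zy|c x xy|x h].
- by rewrite dot0l.
- by rewrite formDl xy zy addr0.
- by rewrite formZl xy mulr0.
- exact: dot_eq0_limit.
Qed.

Lemma closed_orthogonalr x : closed_subspace [set y | dot x y = 0].
Proof.
have -> : [set y | dot x y = 0] = [set y | dot y x = 0]; last first.
  exact: closed_orthogonal.
by apply/seteqP; split=> y /dot_eq0C.
Qed.

Definition cspan S : set H :=
  [set x | forall K, closed_subspace K -> S `<=` K -> K x].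

Lemma closed_cspan S : closed_subspace (cspan S).
Proof.
split=> [K cK _|x y Sx Sy K cK SK|c x Sx K cK SK|x h K cK SK].
- exact: csub0.
- by apply: csubD => //; [apply: Sx|apply: Sy].
- by apply: csubZ => //; apply: Sx.
- apply: csub_lim => // e /h[z Sz xz]; exists z => //; exact: Sz.
Qed.

Lemma sub_cspan S : S `<=` cspan S.
Proof. by move=> x Sx K _; apply. Qed.

Lemma cspan_min S K : closed_subspace K -> S `<=` K -> cspan S `<=` K.
Proof. by move=> cK SK x; apply. Qed.

(** ** Angles *)

Definition norm x : R := Num.sqrt (nsq x).

Lemma normD x y : norm (x + y) <= norm x + norm y.
Proof.
rewrite /norm -(@ler_pXn2r _ 2) ?nnegrE ?addr_ge0 ?sqrtr_ge0 //.
rewrite sqrrD !sqr_sqrtr ?nsq_ge0 // nsqD.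
have : complex.Re (dot x y) <= Num.sqrt (nsq x) * Num.sqrt (nsq y).
  rewrite -sqrtrM ?nsq_ge0 //.
  apply: le_trans (ler_norm _) _; rewrite -sqrtr_sqr ler_wsqrtr //.
  by apply: le_trans (cauchy_schwarz _ _); rewrite lerDl sqr_ge0.
lra.
Qed.

Lemma normB_le x y : norm x <= norm y + norm (x - y).
Proof. by apply: le_trans (normD _ _); rewrite subrKC. Qed.

(** The inequality [c * nsq x <= nsq (x + z)] says that the vectors [x] and [z]
    form an angle bounded away from zero.  Taking square roots turns both sides
    into Lipschitz functions, so that it passes to limits. *)
Lemma angle_closure S S' (c : R) x z : 0 <= c ->
  (forall x z, S x -> S' z -> c * nsq x <= nsq (x + z)) ->
  (forall e : R, 0 < e -> exists2 w, S w & nsq (x - w) < e) ->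
  (forall e : R, 0 < e -> exists2 w, S' w & nsq (z - w) < e) ->
  c * nsq x <= nsq (x + z).
Proof.
move=> c0 h hx hz.
suff : Num.sqrt c * norm x <= norm (x + z).
  rewrite /norm -sqrtrM // => hn; rewrite -ler_sqrt ?nsq_ge0 //.
apply/ler_addgt0Pr => e e0; set s := Num.sqrt c.
have s0 : 0 <= s by exact: sqrtr_ge0.
pose r := e / (s + 2); have r0 : 0 < r by rewrite divr_gt0 //; lra.
have small w : nsq w < r ^+ 2 -> norm w <= r.
  move=> /ltW hw; apply: le_trans (ler_wsqrtr hw) _.
  by rewrite sqrtr_sqr ger0_norm // ltW.
have r20 : 0 < r ^+ 2 by rewrite exprn_gt0.
have [x' Sx' /small hx'] := hx _ r20; have [z' Sz' /small hz'] := hz _ r20.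
have h1 : s * norm x' <= norm (x' + z').
  by rewrite /s /norm -sqrtrM // ler_wsqrtr // h.
have h2 := normB_le x x'; have h3 := normB_le (x' + z') (x + z).
have h4 : norm (x' + z' - (x + z)) <= r + r.
  rewrite opprD addrACA; apply: le_trans (normD _ _) _.
  by rewrite /norm (nsqBC x') (nsqBC z') lerD.
have h5 : e = s * r + 2 * r by rewrite /r; field; lra.
have h6 : s * norm x <= s * norm x' + s * r.
  by rewrite -mulrDr ler_wpM2l //; lra.
by lra.
Qed.

(** ** Projections *)

Definition is_oproj K x p := K p /\ forall w, K w -> dot (x - p) w = 0.

Lemma cauchy_of_rate (c : R) (u : nat -> H) : 0 < c ->
  (forall n m, nsq (u n - u m) <= c * (n.+1%:R^-1 + m.+1%:R^-1)) ->
  forall e : R, 0 < e -> exists n, forall m, (n <= m)%N -> nsq (u m - u n) < e.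
Proof.
move=> c0 h e e0; have [|n] := @ltr_add_invr _ 0 (e / c / 2).
  by rewrite !divr_gt0.
rewrite add0r => ne; exists n => m nm; apply: le_lt_trans (h m n) _.
have : m.+1%:R^-1 <= n.+1%:R^-1 :> R.
  by rewrite lef_pV2 ?posrE ?ltr0n // ler_nat.
move: n.+1%:R^-1 m.+1%:R^-1 ne => a b ae ba.
rewrite mulrC -ltr_pdivlMr //; move: (e / c) ae => r; lra.
Qed.

(** A minimizing sequence for the distance is Cauchy by the parallelogram
    law; its limit is closest to [x], hence the projection. *)
Lemma oproj_exists K x : closed_subspace K -> exists p, is_oproj K x p.
Proof.
move=> cK; pose D := [set r | exists2 z, K z & r = nsq (x - z)].
have Dlb : has_lbound D by exists 0 => _ [z _ ->]; exact: nsq_ge0.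
have Dinf : has_inf D by split => //; exists (nsq (x - 0)); exists 0; first exact: csub0.
have mem z : K z -> inf D <= nsq (x - z).
  by move=> Kz; apply: ge_inf => //; exists z.
have /choice[u uP] : forall n : nat, exists z, K z /\
    nsq (x - z) < inf D + n.+1%:R^-1.
  move=> n; have [|_ [z Kz ->] hz] := @inf_adherent _ D n.+1%:R^-1 _ Dinf.
    by rewrite invr_gt0.
  by exists z.
have Ku n : K (u n) := (uP n).1.
have [|p pP] := form_complete (h := dot) (u := u).
  apply: (@cauchy_of_rate 2) => // n m.
  have := parallelogram (x - u n) (x - u m).
  have -> : x - u n - (x - u m) = u m - u n.
    by rewrite opprB addrC addrA subrK.
  rewrite (nsqBC (u m)).
  have -> : x - u n + (x - u m) = 2%:R *: (x - 2%:R^-1 *: (u n + u m)).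
    rewrite scalerBr scalerA mulfV ?pnatr_eq0 // scale1r scaler_nat mulr2n.
    by rewrite addrACA opprD.
  rewrite nsqZ.
  have := mem (2%:R^-1 *: (u n + u m)) (csubZ cK _ (csubD cK (Ku n) (Ku m))).
  have -> : complex.Re (2%:R : R[i]) = 2%:R by [].
  have -> : complex.Im (2%:R : R[i]) = 0 by rewrite /= addr0.
  rewrite expr0n addr0; have := (uP n).2; have := (uP m).2.
  move: (n.+1%:R^-1) (m.+1%:R^-1) => a b; lra.
have Kp : K p.
  apply: (csub_lim cK) => e /pP[n /(_ n (leqnn n)) hn].
  by exists (u n) => //; rewrite nsqBC.
have pinf : nsq (x - p) <= inf D.
  apply/ler_addgt0Pr => e e0; set i := inf D.
  have i0 : 0 <= i by apply: lb_le_inf; [exact: Dinf.1|case: Dinf => _ _ _ [z _ ->]; exact: nsq_ge0].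
  pose t := e / (4 * (i + 1)); have t0 : 0 < t by rewrite divr_gt0 //; lra.
  have s0 : 0 < 1 + t^-1 by rewrite addr_gt0 // invr_gt0.
  have [|n hn] := pP (e / 4 / (1 + t^-1)); first by rewrite !divr_gt0 //; lra.
  have [|m hm] := @ltr_add_invr _ 0 (e / 4 / (1 + t)).
    by rewrite !divr_gt0 //; lra.
  have {}hn := hn (maxn n m) (leq_maxl _ _).
  have {}hm : (maxn n m).+1%:R^-1 < e / 4 / (1 + t).
    apply: le_lt_trans hm; rewrite add0r lef_pV2 ?posrE ?ltr0n // ler_nat ltnS.
    exact: leq_maxr.
  move: hn hm; set l := maxn n m => hn hm.
  rewrite -(subrK (u l) x) -addrA.
  apply: le_trans (nsqD_le_weighted _ _ t0) _.
  have h1 : (1 + t^-1) * nsq (u l - p) <= e / 4.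
    by rewrite mulrC -ler_pdivlMr //; exact: ltW.
  have h2 : (1 + t) * l.+1%:R^-1 <= e / 4.
    by rewrite mulrC -ler_pdivlMr ?ltW //; lra.
  have h3 : t * i <= e / 4.
    have -> : t * i = e / 4 * (i / (i + 1)) by rewrite /t; field; lra.
    by rewrite ger_pMr; [rewrite ler_pdivrMr ?mul1r|]; lra.
  have h4 : (1 + t) * nsq (x - u l) <= (1 + t) * (i + l.+1%:R^-1).
    by rewrite ler_pM2l ?ltW //; [exact: (uP l).2|lra].
  move: h1 h2 h3 h4; move: (nsq _) (nsq _) (t^-1) (l.+1%:R^-1) => a b t' r.
  by clearbody i t; nra.
exists p; split=> // w Kw; apply: dot_eq0_min => c.
apply: le_trans pinf _; rewrite -addrA -opprD; apply: mem.
by apply: csubD => //; apply: csubZ.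
Qed.

(** A projection is unique only up to a null vector, hence the choice. *)
Definition oproj K x := xget 0 (is_oproj K x).

Lemma oprojP K x : closed_subspace K -> is_oproj K x (oproj K x).
Proof.
move=> cK; have [p xp] := oproj_exists x cK.
by rewrite /oproj; case: xgetP => [q -> //|/(_ p)].
Qed.

Lemma oproj_in K x : closed_subspace K -> K (oproj K x).
Proof. by move=> cK; case: (oprojP x cK). Qed.

Lemma oproj_orth K x w : closed_subspace K -> K w -> dot (x - oproj K x) w = 0.
Proof. by move=> cK; case: (oprojP x cK) => _; apply. Qed.

Lemma is_oproj_unique K x p q : closed_subspace K ->
  is_oproj K x p -> is_oproj K x q -> nsq (p - q) = 0.
Proof.
move=> cK [Kp xp] [Kq xq]; have Kpq := csubB cK Kp Kq.
rewrite /nsq -[X in dot X _](subrKA x) -opprB formDl dotNl.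
by rewrite xp // xq // oppr0 addr0.
Qed.

(** Two closed subspaces at a positive angle have a closed sum: a sequence of
    sums that is Cauchy has Cauchy components. *)
Lemma closed_sum K L (c : R) : closed_subspace K -> closed_subspace L ->
  0 < c -> (forall x z, K x -> L z -> c * nsq x <= nsq (x + z)) ->
  closed_subspace [set x | exists x1 x2, [/\ K x1, L x2 & x = x1 + x2]].
Proof.
move=> cK cL c0 angle; split=> /=.
- by exists 0, 0; split; [exact: csub0|exact: csub0|rewrite addr0].
- move=> _ _ [x1 [x2 [K1 L1 ->]]] [z1 [z2 [K2 L2 ->]]].
  exists (x1 + z1), (x2 + z2); split; [exact: csubD|exact: csubD|exact: addrACA].
- move=> a _ [x1 [x2 [K1 L1 ->]]].
  exists (a *: x1), (a *: x2); split; [exact: csubZ|exact: csubZ|exact: scalerDr].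
move=> x h.
have /choice[f fP] : forall n : nat, exists z : H * H, [/\ K z.1, L z.2 &
    nsq (x - (z.1 + z.2)) < n.+1%:R^-1].
  move=> n; have [|_ [x1 [x2 [K1 L1 ->]]] hz] := h n.+1%:R^-1.
    by rewrite invr_gt0.
  by exists (x1, x2).
pose u n := (f n).1; pose v n := (f n).2.
have Ku n : K (u n) by case: (fP n).
have Lv n : L (v n) by case: (fP n).
have uvP n : nsq (x - (u n + v n)) < n.+1%:R^-1 by case: (fP n).
have [|l ul] := form_complete (h := dot) (u := u).
  apply: (@cauchy_of_rate (2 / c)); first by rewrite divr_gt0.
  move=> n m; rewrite mulrAC ler_pdivlMr // mulrC.
  apply: le_trans (angle _ _ (csubB cK (Ku n) (Ku m)) (csubB cL (Lv n) (Lv m))) _.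
  have -> : u n - u m + (v n - v m) = x - (u m + v m) - (x - (u n + v n)).
    by rewrite opprB [RHS]addrC [RHS]addrA subrK opprD addrACA.
  apply: le_trans (nsqD_le _ _) _; rewrite nsqN.
  move: (uvP n) (uvP m).
  move: (nsq _) (nsq _) (n.+1%:R^-1) (m.+1%:R^-1) => p q a b; lra.
have Kl : K l.
  by apply: (csub_lim cK) => e /ul[n /(_ n (leqnn n)) hn]; exists (u n) => //; rewrite nsqBC.
exists l, (x - l); split=> //; last by rewrite subrKC.
apply: (csub_lim cL) => e e0; have [|n hn] := ul (e / 4); first by lra.
have [|m] := @ltr_add_invr _ 0 (e / 4); first by lra.
rewrite add0r => hm; exists (v (maxn n m)) => //.
have {}hn := hn (maxn n m) (leq_maxl _ _).
have -> : x - l - v (maxn n m) =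
    x - (u (maxn n m) + v (maxn n m)) + (u (maxn n m) - l).
  by rewrite [RHS]addrACA opprD -!addrA addNKr [- l + _]addrC.
apply: le_lt_trans (nsqD_le _ _) _.
have : (maxn n m).+1%:R^-1 <= m.+1%:R^-1 :> R.
  by rewrite lef_pV2 ?posrE ?ltr0n // ler_nat ltnS leq_maxr.
move: hn hm (uvP (maxn n m)); rewrite -/(nsq _); move: (nsq _) (nsq _) => p q.
move: (m.+1%:R^-1) ((maxn n m).+1%:R^-1) => a b; lra.
Qed.

(** ** Conditional covariance given a closed subspace *)

(** Subtracting the projection from one argument is enough, since the residual
    is orthogonal to the projection of the other: see [ccovC]. *)
Definition ccov K x y := dot (x - oproj K x) y.

Lemma ccovC K x y : closed_subspace K -> ccov K y x = (ccov K x y)^*.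
Proof.
move=> cK; rewrite /ccov.
have e z w : dot (z - oproj K z) w = dot (z - oproj K z) (w - oproj K w).
  by rewrite dotBr (oproj_orth _ cK (oproj_in w cK)) subr0.
by rewrite e [in RHS]e -formC.
Qed.

Lemma ccovDr K x y z : ccov K x (y + z) = ccov K x y + ccov K x z.
Proof. exact: dotDr. Qed.

Lemma ccovDl K x y z : closed_subspace K ->
  ccov K (x + y) z = ccov K x z + ccov K y z.
Proof. by move=> cK; rewrite ccovC // ccovDr rmorphD /= -!ccovC. Qed.

Lemma ccov_orthl K x y : closed_subspace K ->
  (forall w, K w -> dot x w = 0) -> ccov K x y = dot x y.
Proof.
move=> cK xK; have Kp := oproj_in x cK; have := oproj_orth x cK Kp.
rewrite dotBl xK // sub0r => /eqP; rewrite oppr_eq0 => /eqP pp.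
by rewrite /ccov dotBl (@nsq_eq0_dot (oproj K x)) ?subr0 // /nsq pp.
Qed.

Lemma ccov_in K x y : closed_subspace K -> K x -> ccov K x y = 0.
Proof.
move=> cK Kx; apply: nsq_eq0_dot; rewrite /nsq oproj_orth //.
by apply: csubB => //; exact: oproj_in.
Qed.

Lemma closed_ccov0 K y : closed_subspace K ->
  closed_subspace [set x | ccov K x y = 0].
Proof.
move=> cK; have -> : [set x | ccov K x y = 0] = [set x | dot x (y - oproj K y) = 0].
  apply/seteqP; split=> x /= h.
    by rewrite formC -/(ccov K y x) ccovC // h !rmorph0.
  by rewrite ccovC // /ccov formC h !rmorph0.
exact: closed_orthogonal.
Qed.

Lemma oproj_id K x : closed_subspace K -> K x -> nsq (oproj K x - x) = 0.
Proof.
move=> cK Kx; apply: (is_oproj_unique cK (oprojP x cK)).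
by split=> // w _; rewrite subrr dot0l.
Qed.

(** The law of total covariance. *)
Lemma ccov_tower K L x y : closed_subspace K -> closed_subspace L -> K `<=` L ->
  ccov K x y = ccov K (oproj L x) y + ccov L x y.
Proof.
move=> cK cL KL; rewrite -[X in ccov K X _](subrK (oproj L x)) ccovDl // addrC.
congr (_ + _); rewrite ccov_orthl // => w Kw.
by rewrite (oproj_orth _ cL (KL _ Kw)).
Qed.

(** The covariances given [L n] and given [K] differ by the product of [y] with
    the difference of the two projections, which tends to zero. *)
Lemma ccov_limit K x y (L : nat -> set H) :
  (forall n, ccov (L n) x y = 0) ->
  (forall e : R, 0 < e -> exists n, nsq (oproj (L n) x - oproj K x) < e) ->
  ccov K x y = 0.
Proof.
move=> L0 h; apply: dot_eq0_limit => e /h[n hn]; exists (x - oproj (L n) x); first exact: L0.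
by rewrite opprB addrC addrA subrK.
Qed.

(** The difference of the two projections is orthogonal to the smaller one. *)
Lemma oproj_mono K L x : closed_subspace K -> closed_subspace L -> K `<=` L ->
  nsq (oproj L x) = nsq (oproj K x) + nsq (oproj L x - oproj K x).
Proof.
move=> cK cL KL; rewrite -pythagoras; first by rewrite addrC subrK.
apply: dot_eq0C; have Kp := oproj_in x cK.
rewrite -[X in dot X _](subrKA x) addrC formDl (oproj_orth _ cK Kp) add0r.
by rewrite -opprB dotNl (oproj_orth _ cL (KL _ Kp)) oppr0.
Qed.

(** Along a decreasing sequence the squared norms of the projections decrease,
    so by Pythagoras the projections are Cauchy; their limit lies in every
    member of the sequence. *)
Lemma oproj_decreasing (L : nat -> set H) K x :
  (forall n, closed_subspace (L n)) -> closed_subspace K ->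
  (forall n m, (n <= m)%N -> L m `<=` L n) ->
  (forall n, K `<=` L n) -> \bigcap_n L n `<=` K ->
  forall e : R, 0 < e -> exists n, nsq (oproj (L n) x - oproj K x) < e.
Proof.
move=> cL cK Lm KL LK; pose p n := oproj (L n) x.
pose D := range (fun n => nsq (p n)).
have Dinf : has_inf D.
  split; first by exists (nsq (p 0%N)); exists 0%N.
  by exists 0 => _ [n _ <-]; exact: nsq_ge0.
have [|q pq] := form_complete (h := dot) (u := p).
  move=> e e0; have [_ [n _ <-] hn] := inf_adherent e0 Dinf.
  exists n => m nm; rewrite -/(nsq _) nsqBC; rewrite (oproj_mono _ (cL m) (cL n) (Lm _ _ nm)) in hn.
  have : inf D <= nsq (p m) by apply: ge_inf; [exact: Dinf.2|exists m].
  by move: hn; rewrite -/(p m) -/(p n); lra.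
have Kq : K q.
  apply: LK => n _; apply: (csub_lim (cL n)) => e /pq[m hm].
  exists (p (maxn n m)); last by rewrite nsqBC hm // leq_maxr.
  by apply: (Lm n); [exact: leq_maxl|exact: oproj_in].
have xq : is_oproj K x q.
  split=> // w Kw; apply: dot_eq0_limit => e /pq[n /(_ n (leqnn n)) hn].
  exists (x - p n); first exact: oproj_orth (KL n _ Kw).
  by rewrite opprB addrC addrA subrK.
have q0 := is_oproj_unique cK xq (oprojP x cK).
move=> e e0; have [|n hn] := pq (e / 2); first by lra.
exists n; rewrite -[X in X - oproj K x](subrK q) -addrA.
apply: le_lt_trans (nsqD_le _ _) _; rewrite q0.
by have := hn n (leqnn n); lra.
Qed.

Lemma closed_closure S : S 0 -> (forall x y, S x -> S y -> S (x + y)) ->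
  (forall c x, S x -> S (c *: x)) ->
  closed_subspace [set y | forall e : R, 0 < e -> exists2 z, S z & nsq (y - z) < e].
Proof.
move=> S0 SD SZ; split=> /=.
- by move=> e e0; exists 0 => //; rewrite subrr nsq0.
- move=> x y hx hy e e0; have e4 : 0 < e / 4 by lra.
  have [z Sz xz] := hx _ e4; have [w Sw yw] := hy _ e4.
  exists (z + w); first exact: SD.
  rewrite opprD addrACA; apply: le_lt_trans (nsqD_le _ _) _; lra.
- move=> a x hx e e0; set b := complex.Re a ^+ 2 + complex.Im a ^+ 2.
  have b0 : 0 <= b by rewrite addr_ge0 ?sqr_ge0.
  have [|z Sz xz] := hx (e / (b + 1)); first by rewrite divr_gt0 //; lra.
  exists (a *: z); first exact: SZ.
  rewrite -scalerBr nsqZ -/b; apply: le_lt_trans (ler_wpM2l b0 (ltW xz)) _.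
  by rewrite mulrCA gtr_pMr // ltr_pdivrMr ?mul1r; lra.
- move=> x hx e e0; have e4 : 0 < e / 4 by lra.
  have [z hz xz] := hx _ e4; have [w Sw zw] := hz _ e4.
  exists w => //; rewrite -(subrK z x) -addrA.
  apply: le_lt_trans (nsqD_le _ _) _; lra.
Qed.

Lemma closed_limit_union (L : nat -> set H) :
  (forall n, closed_subspace (L n)) -> (forall n m, (n <= m)%N -> L n `<=` L m) ->
  closed_subspace [set y | forall e : R, 0 < e ->
    exists2 z, (exists n, L n z) & nsq (y - z) < e].
Proof.
move=> cL Lm; apply: closed_closure.
- by exists 0%N; exact: csub0.
- move=> x y [n Lx] [m Ly]; exists (maxn n m); apply: csubD => //.
    by apply: Lm Lx; exact: leq_maxl.
  by apply: Lm Ly; exact: leq_maxr.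
- by move=> c x [n Lx]; exists n; exact: csubZ.
Qed.

(** [oproj (L n) x] is also the projection of [oproj K x], hence at least as
    close to it as any element of [L n]. *)
Lemma oproj_increasing (L : nat -> set H) K x :
  (forall n, closed_subspace (L n)) -> closed_subspace K ->
  (forall n, L n `<=` K) ->
  (forall y, K y -> forall e : R, 0 < e -> exists2 z, (exists n, L n z) & nsq (y - z) < e) ->
  forall e : R, 0 < e -> exists n, nsq (oproj (L n) x - oproj K x) < e.
Proof.
move=> cL cK LK dense e e0; have [z [n Lz] hz] := dense _ (oproj_in x cK) _ e0.
exists n; apply: le_lt_trans hz; rewrite nsqBC.
rewrite -[X in _ <= nsq (_ - X)](subrK (oproj (L n) x)) opprD addrA.
have Lzp := csubB (cL n) Lz (oproj_in x (cL n)).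
rewrite addrAC [X in _ <= X]pythagoras; first by rewrite nsqN nsqBC lerDr nsq_ge0.
rewrite dotNr; apply/eqP; rewrite oppr_eq0; apply/eqP; apply: dot_eq0C.
rewrite -[X in dot X _](subrKA x) formDl (oproj_orth _ (cL n) Lzp) addr0.
by rewrite -opprB dotNl (oproj_orth _ cK (LK n _ Lzp)) oppr0.
Qed.

Definition corth L1 L2 K := forall x y, L1 x -> L2 y -> ccov K x y = 0.

Lemma corth_cspan S1 S2 K : closed_subspace K ->
  (forall x y, S1 x -> S2 y -> ccov K x y = 0) -> corth (cspan S1) (cspan S2) K.
Proof.
move=> cK h x y; move: x; have h1 z : S1 z -> cspan S2 `<=` [set x | ccov K x z = 0].
  by move=> Sz; apply: cspan_min; [exact: closed_ccov0|move=> w Sw /=; rewrite ccovC // h // rmorph0].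
move=> x Sx Sy; suff : cspan S1 `<=` [set x | ccov K x y = 0] by apply.
by apply: cspan_min; [exact: closed_ccov0|move=> w Sw /=; rewrite ccovC // h1 // rmorph0].
Qed.

End Hilbert.

(** * Linear spaces of a family of vectors indexed by vertices and times *)

Section Family.
Context {R : realType} {H : lmodType R[i]} (dot : hilbert_form H).
Context {V : finType} (y : V -> R -> H).
Implicit Types (A B C W : {set V}) (J : set (V * R)).

(** Sets of pairs of a vertex and a time make joins of spaces into unions of
    index sets. *)
Definition gens J : set H := [set x | exists2 j, J j & x = y j.1 j.2].
Definition space J : set H := cspan dot (gens J).
Definition past A (t : R) : set (V * R) := [set j | j.1 \in A /\ j.2 <= t].
Definition window A (t : R) : set (V * R) :=
  [set j | j.1 \in A /\ t <= j.2 <= t + 1].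
Definition always A : set (V * R) := [set j | j.1 \in A].

Lemma closed_space J : closed_subspace dot (space J).
Proof. exact: closed_cspan. Qed.
#[local] Hint Resolve closed_space : core.

Lemma mem_space J a u : J (a, u) -> space J (y a u).
Proof. by move=> Jau; apply: sub_cspan; exists (a, u). Qed.

Lemma space_min J K : closed_subspace dot K ->
  (forall a u, J (a, u) -> K (y a u)) -> space J `<=` K.
Proof. by move=> cK h; apply: cspan_min => // _ [[a u] Jau ->]; exact: h. Qed.

Lemma space_mono J J' : J `<=` J' -> space J `<=` space J'.
Proof. by move=> JJ; apply: space_min => // a u /JJ; exact: mem_space. Qed.

Lemma past_mono A B s t : A \subset B -> s <= t -> past A s `<=` past B t.
Proof.
by move=> /fintype.subsetP AB st [a u] [/= /AB ? us]; split => //=; exact: le_trans us st.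
Qed.

Lemma corth_space J J' K : closed_subspace dot K ->
  (forall a u b v, J (a, u) -> J' (b, v) -> ccov dot K (y a u) (y b v) = 0) ->
  corth dot (space J) (space J') K.
Proof.
move=> cK h; apply: corth_cspan => // _ _ [[a u] Ja ->] [[b v] Jb ->]; exact: h.
Qed.

Definition comb (s : seq (R[i] * (V * R))) : H :=
  \sum_(p <- s) p.1 *: y p.2.1 p.2.2.

(** The passage from the abstract closed span to actual linear combinations. *)
Lemma space_comb J x : space J x -> forall e : R, 0 < e ->
  exists2 z, (exists2 s, {in s, forall p, J p.2} & z = comb s) & nsq dot (x - z) < e.
Proof.
pose S := [set z | exists2 s, {in s, forall p, J p.2} & z = comb s].
suff : space J `<=` [set x | forall e : R, 0 < e -> exists2 z, S z & nsq dot (x - z) < e].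
  by apply.
apply: space_min; first apply: (@closed_closure _ _ dot S).
- by exists [::] => //; rewrite /comb big_nil.
- move=> _ _ [s1 J1 ->] [s2 J2 ->]; exists (s1 ++ s2); last by rewrite /comb big_cat.
  by move=> p; rewrite mem_cat => /orP[/J1|/J2].
- move=> c _ [s Js ->]; exists [seq (c * p.1, p.2) | p <- s].
    by move=> _ /mapP[p ps ->]; exact: (Js p).
  by rewrite /comb big_map scaler_sumr; apply: eq_bigr => p _; rewrite scalerA.
move=> a u Jau e e0; exists (y a u); last by rewrite subrr nsq0.
exists [:: (1, (a, u))]; last by rewrite /comb big_seq1 scale1r.
by move=> p; rewrite inE => /eqP ->.
Qed.

Lemma comb_space J s : {in s, forall p, J p.2} -> space J (comb s).
Proof.
rewrite /comb; elim: s => [|[c [a u]] s IH] Js.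
  by rewrite big_nil; exact: (csub0 (closed_space _)).
rewrite big_cons; apply: (csubD (closed_space _)).
  by apply: (csubZ (closed_space _)); apply: mem_space; apply: (Js (c, (a, u))); rewrite mem_head.
by apply: IH => p ps; apply: Js; rewrite inE ps orbT.
Qed.

Section PositiveAngle.
Context (c : R) (c_gt0 : 0 < c).
Hypothesis angle : forall A x z,
  space (always A) x -> space (always (~: A)) z -> c * nsq dot x <= nsq dot (x + z).

(** Sums of vectors over [A] and over its complement form a closed subspace,
    because of the angle, and it contains the generators. *)
Lemma space_split J A x : space J x ->
  exists x1 x2, [/\ space (J `&` always A) x1, space (J `&` always (~: A)) x2 &
                    x = x1 + x2].
Proof.
pose S := [set x | exists x1 x2, [/\ space (J `&` always A) x1,
  space (J `&` always (~: A)) x2 & x = x1 + x2]].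
suff : space J `<=` S by apply.
apply: space_min => [|a u Jau].
  apply: (closed_sum _ _ c_gt0) => // z w hz hw; apply: (@angle A).
    by apply: space_mono hz => j [].
  by apply: space_mono hw => j [].
have [aA|aA] := boolP (a \in A).
  exists (y a u), 0; split; rewrite ?addr0 //.
    exact: mem_space.
  exact: (csub0 (closed_space _)).
exists 0, (y a u); split; rewrite ?add0r //.
  exact: (csub0 (closed_space _)).
by apply: mem_space; split => //; rewrite /always /= inE.
Qed.

Lemma space_indep A x z : space (always A) x -> space (always (~: A)) z ->
  nsq dot (x + z) = 0 -> nsq dot x = 0.
Proof.
move=> Ax Az xz; have := angle Ax Az; rewrite xz pmulr_rle0 // => x0.
by apply/eqP; rewrite eq_le x0 nsq_ge0.
Qed.

(** The part off [B] of a vector of the past of [A] vanishes when the vector also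
    lies in the past of [B], by uniqueness of the decomposition. *)
Lemma space_past_inter A B t x : space (past A t) x -> space (past B t) x ->
  space (past (A :&: B) t) x.
Proof.
move=> Ax Bx; have [x1 [x2 [hx1 hx2 xE]]] := space_split B Ax.
have hx1' : space (past (A :&: B) t) x1.
  by apply: space_mono hx1 => -[a u] [[/= aA ut] aB]; split => //; rewrite /= inE aA.
apply: (csub_null (closed_space _) hx1'); rewrite xE addrC addKr.
apply: (@space_indep (~: B) _ (x1 - x)).
- by apply: space_mono hx2 => j [].
- rewrite finset.setCK; apply: (csubB (closed_space _)); first by apply: space_mono hx1 => j [].
  by apply: space_mono Bx => j [].
- by rewrite xE opprD addNKr subrr nsq0.
Qed.

Definition noncausal_at a b := forall t u v : R, t <= u <= t + 1 -> v <= t ->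
  ccov dot (space (past (~: [set a])%SET t)) (y b u) (y a v) = 0.

Definition uncorrelated_at a b := forall t u v : R,
  t <= u <= t + 1 -> t <= v <= t + 1 ->
  ccov dot (space (past [set: V]%SET t)) (y a u) (y b v) = 0.

(** If [a] adds nothing to the prediction of [b] by the other vertices, that
    prediction is also the one by all vertices. *)
Lemma predictor_avoids a b t u : noncausal_at a b -> t <= u <= t + 1 ->
  space (past (~: [set a])%SET t) (oproj dot (space (past [set: V]%SET t)) (y b u)).
Proof.
move=> nab tu; pose L := space (past (~: [set a])%SET t).
have Lp := oproj_in (y b u) (closed_space (past (~: [set a])%SET t)).
apply: (csub_null (closed_space _) Lp).
apply: (is_oproj_unique (closed_space _) (oprojP _ (closed_space _))).
split; first by apply: space_mono Lp; apply: past_mono; rewrite ?finset.subsetT.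
apply: space_min; first exact: closed_orthogonalr.
move=> a' v [_ /= vt]; have [->|aa'] := eqVneq a' a; first exact: nab.
by apply: oproj_orth => //; apply: mem_space; split; rewrite //= !inE.
Qed.

(** Vertices are removed one at a time from the past, intersecting pasts. *)
Lemma predictor_parents W b t u : (forall a, a \notin W -> noncausal_at a b) ->
  t <= u <= t + 1 ->
  space (past W t) (oproj dot (space (past [set: V]%SET t)) (y b u)).
Proof.
move=> nW tu; set p := oproj _ _ _.
have h (s : seq V) : (forall a, a \in s -> noncausal_at a b) ->
    space (past [set a | a \notin s]%SET t) p.
  elim: s => [_|a s IH hs].
    have -> : [set a | a \notin [::]]%SET = [set: V]%SET by apply/setP => a; rewrite !inE.
    exact: (oproj_in _ (closed_space _)).
  have -> : [set a' | a' \notin a :: s]%SET = (~: [set a]%SET :&: [set a | a \notin s])%SET.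
    by apply/setP => a'; rewrite !inE negb_or.
  apply: space_past_inter.
    by apply: predictor_avoids => //; apply: hs; rewrite mem_head.
  by apply: IH => a' a's; apply: hs; rewrite inE a's orbT.
have -> : W = [set a | a \notin enum (~: W)]%SET.
  by apply/setP => a; rewrite !inE mem_enum inE negbK.
by apply: h => a; rewrite mem_enum inE; exact: nW.
Qed.

Section Separation.
Context (A B C M N : {set V}).
Hypotheses (AM : A \subset M) (BN : B \subset N).
Hypotheses (CMN : C \subset M :|: N).
Hypotheses (MAC : M \subset A :|: C) (NBC : N \subset B :|: C).
Hypothesis ncM : forall a b, a \notin A :|: C -> b \in M -> noncausal_at a b.
Hypothesis ncN : forall a b, a \notin B :|: C -> b \in N -> noncausal_at a b.
Hypothesis ucMN : forall a b, a \in M -> b \in N -> uncorrelated_at a b.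
Hypothesis pnd : forall x,
  (forall t, space (past [set: V]%SET t) x) -> nsq dot x = 0.

Definition known t s := past C t `|` past (M :|: N) s.

Definition separated_until t s := forall a b u v,
  a \in A -> b \in B -> u <= t -> v <= t ->
  ccov dot (space (known t s)) (y a u) (y b v) = 0.

(** At the starting time everything is known, so nothing is left to correlate. *)
Lemma separated_until_now s : separated_until s s.
Proof.
move=> a b u v aA bB us vs; apply: ccov_in => //; apply: mem_space; right.
by split=> //=; rewrite inE (fintype.subsetP AM).
Qed.

(** One unit of time adds the window of [M] to the side [F] of [A] and the window
    of [N] to the side [G] of [B].  Both predictors from the whole past [L] stay
    on their side, and the innovations are orthogonal, so [F] and [G] remain
    orthogonal given the old information [K].  The new information is [K] with
    the windows of the vertices of [C], each of which belongs to [F] or to [G],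
    and conditioning further on part of [F] and part of [G] preserves
    orthogonality: the residual [r] of a vector of [F] given [K] and the part in
    [F] is orthogonal to [K], hence to all of [G]. *)
Lemma separated_until_step s t : s <= t ->
  separated_until t s -> separated_until (t + 1) s.
Proof.
move=> st IH; pose K := space (known t s); pose L := space (past [set: V]%SET t).
have cK : closed_subspace dot K := closed_space _.
have cL : closed_subspace dot L := closed_space _.
have KL : K `<=` L.
  by apply: space_mono => j [|]; apply: past_mono; rewrite ?finset.subsetT.
pose F0 := past (A :|: C) t `|` past (M :|: N) s.
pose G0 := past (B :|: C) t `|` past (M :|: N) s.
have F0L : space F0 `<=` L by apply: space_mono => j [|]; apply: past_mono; rewrite ?finset.subsetT.
have G0L : space G0 `<=` L by apply: space_mono => j [|]; apply: past_mono; rewrite ?finset.subsetT.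
(* The induction hypothesis, with the known variables thrown in on both sides. *)
have FG0 : corth dot (space F0) (space G0) K.
  apply: corth_space => // a u b v Fa Gb.
  have [Ka|nKa] := pselect (known t s (a, u)).
    by apply: ccov_in => //; exact: mem_space.
  have [Kb|nKb] := pselect (known t s (b, v)).
    by rewrite ccovC // ccov_in ?rmorph0 //; exact: mem_space.
  case: Fa => [[/= aAC ut]|]; last by move=> h; case: nKa; right.
  case: Gb => [[/= bBC vt]|]; last by move=> h; case: nKb; right.
  move: aAC; rewrite inE => /orP[aA|aC]; last by case: nKa; left.
  move: bBC; rewrite inE => /orP[bB|bC]; last by case: nKb; left.
  exact: IH.
pose F := F0 `|` window M t; pose G := G0 `|` window N t.
have FF0 a u : F (a, u) -> space F0 (oproj dot L (y a u)).
  move=> [Fa|[/= aM tu]].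
    have Fy := mem_space Fa; apply: (csub_null (closed_space _) Fy).
    by apply: oproj_id => //; exact: F0L.
  apply: (@space_mono (past (A :|: C) t)); first by move=> j; left.
  by apply: predictor_parents => // a' a'AC; exact: ncM.
have GG0 a u : G (a, u) -> space G0 (oproj dot L (y a u)).
  move=> [Fa|[/= aM tu]].
    have Fy := mem_space Fa; apply: (csub_null (closed_space _) Fy).
    by apply: oproj_id => //; exact: G0L.
  apply: (@space_mono (past (B :|: C) t)); first by move=> j; left.
  by apply: predictor_parents => // a' a'AC; exact: ncN.
have FGL a u b v : F (a, u) -> G (b, v) -> ccov dot L (y a u) (y b v) = 0.
  move=> [Fa|[/= aM tu]].
    by move=> _; apply: ccov_in => //; apply: F0L; exact: mem_space.
  move=> [Gb|[/= bN tv]]; last exact: ucMN.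
  by rewrite ccovC // ccov_in ?rmorph0 //; apply: G0L; exact: mem_space.
have FG : corth dot (space F) (space G) K.
  apply: corth_space => // a u b v Fa Gb.
  rewrite (@ccov_tower _ _ _ K L) // FGL // addr0 ccovC //.
  rewrite (@ccov_tower _ _ _ K L) // [ccov _ L _ _]ccovC // (@ccov_in _ _ _ L) //;
    last exact: (oproj_in _ cL).
  by rewrite rmorph0 addr0 ccovC // FG0 ?rmorph0 //; [exact: FF0|exact: GG0].
(* Times up to [t + 1] are before [t] or in the window. *)
have splitF a u : a \in M -> u <= t + 1 -> space F (y a u).
  move=> aM ut1; apply: mem_space; case: (leP u t) => [ut|/ltW tu].
    by left; left; split=> //=; exact: (fintype.subsetP MAC).
  by right; split=> //=; rewrite tu.
have splitG a u : a \in N -> u <= t + 1 -> space G (y a u).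
  move=> aM ut1; apply: mem_space; case: (leP u t) => [ut|/ltW tu].
    by left; left; split=> //=; exact: (fintype.subsetP NBC).
  by right; split=> //=; rewrite tu.
move=> a b u v aA bB ut vt.
(* The known variables together with the part of the new information in [F]. *)
pose F' := known t s `|` past (C :&: M) (t + 1).
pose r := y a u - oproj dot (space F') (y a u).
have F'F : space F' `<=` space F.
  apply: space_min => // e w [[[/= cC wt]|h]|[/= + wt]].
  - by apply: mem_space; left; left; split=> //=; rewrite inE cC orbT.
  - by apply: mem_space; left; right.
  - by rewrite inE => /andP[_ cM]; exact: splitF.
have KF' : K `<=` space F' by apply: space_mono => j; left.
have Fr : space F r.
  apply: (csubB (closed_space _)); last exact: (F'F _ (oproj_in _ (closed_space _))).
  by apply: splitF => //; exact: (fintype.subsetP AM).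
have rF' w : space F' w -> dot r w = 0 by exact: oproj_orth.
have rG w : space G w -> dot r w = 0.
  move=> Gw; rewrite -(ccov_orthl w (closed_space (known t s))); first exact: FG.
  by move=> z /KF'; exact: rF'.
have rK' w : space (known (t + 1) s) w -> dot r w = 0.
  move: w; apply: space_min; first exact: closed_orthogonalr.
  move=> e w [[/= cC wt]|h] /=; last by apply: rF'; apply: mem_space; left; right.
  have := fintype.subsetP CMN _ cC; rewrite inE => /orP[cM|cN].
    by apply: rF'; apply: mem_space; right; split=> //=; rewrite inE cC.
  by apply: rG; exact: splitG.
have F'K' : space F' `<=` space (known (t + 1) s).
  apply: space_mono => j [[h|h]|h].
  - by left; apply: past_mono h => //; rewrite lerDl.
  - by right.
  - by left; apply: past_mono h => //; exact: finset.subsetIl.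
rewrite -[y a u](subrK (oproj dot (space F') (y a u))) ccovDl // -/r.
rewrite [X in _ + X]ccov_in ?addr0 //; last exact: (F'K' _ (oproj_in _ (closed_space _))).
by rewrite ccov_orthl //; apply: rG; apply: splitG => //; exact: (fintype.subsetP BN).
Qed.

Lemma separated_until_nat s n : separated_until (s + n%:R) s.
Proof.
elim: n => [|n IH]; first by rewrite addr0; exact: separated_until_now.
by rewrite -natr1 addrA; apply: separated_until_step => //; rewrite lerDl.
Qed.

(** The component off [C] does not depend on [n] by uniqueness of the
    decomposition, so it lies in the remote past and is null. *)
Lemma remote_past t :
  \bigcap_n space (known t (t - n%:R)) `<=` space (past C t).
Proof.
move=> x hx.
have /choice[f fP] : forall n : nat, exists z : H * H,
    [/\ space (past C t) z.1,
        space (past [set: V]%SET (t - n%:R) `&` always (~: C)) z.2 & x = z.1 + z.2].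
  move=> n; have [x1 [x2 [h1 h2 xE]]] := space_split C (hx n I).
  exists (x1, x2); split=> //=.
    apply: space_mono h1 => j [[//|[/= _ jt]] jC]; split=> //.
    by apply: le_trans jt _; rewrite gerBl.
  apply: space_mono h2 => j [[[/= jC _]|[/= _ jt]] nC]; split=> //.
  by move: nC; rewrite /always /= inE jC.
case: (fP 0%N) => h1 h2 xE; apply: (csub_null (closed_space _) h1).
rewrite xE addrC addKr; apply: pnd => t'.
have [n hn] : exists n : nat, t - n%:R <= t'.
  have [n] := (archi_boundP (normr_ge0 (t - t'))).
  exists (Num.Def.archi_bound `|t - t'|).
  by rewrite lerBlDl -lerBlDr; apply: le_trans (ler_norm _) (ltW _).
case: (fP n) => h1' h2' xE'.
have : space (past [set: V]%SET t') (f n).2.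
  by apply: space_mono h2' => j [[/= _ jt] _]; split=> //=; exact: le_trans jt hn.
move=> /(csub_null (closed_space _)); apply.
apply: (@space_indep (~: C) _ ((f 0%N).1 - (f n).1)).
- by apply: (csubB (closed_space _)); [apply: space_mono h2|apply: space_mono h2'] => j [].
- rewrite finset.setCK.
  by apply: (csubB (closed_space _)); [apply: space_mono h1|apply: space_mono h1'] => j [].
- by rewrite addrACA -opprD [X in X - _]addrC -xE [X in _ - X]addrC -xE' subrr nsq0.
Qed.

Lemma separated_past t a b u v : a \in A -> b \in B -> u <= t -> v <= t ->
  ccov dot (space (past C t)) (y a u) (y b v) = 0.
Proof.
move=> aA bB ut vt.
apply: (@ccov_limit _ _ _ _ _ _ (fun n : nat => space (known t (t - n%:R)))).
  by move=> n; have := @separated_until_nat (t - n%:R) n; rewrite subrK; apply.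
apply: oproj_decreasing => //.
- move=> n m nm; apply: space_mono => j [|h]; [by left|right].
  by apply: past_mono h => //; rewrite lerB // ler_nat.
- by move=> n; apply: space_mono => j; left.
- exact: remote_past.
Qed.

(** The past of [C] exhausts all of [C] along a sequence of times. *)
Lemma separated_always : corth dot (space (always A)) (space (always B)) (space (always C)).
Proof.
apply: corth_space => // a u b v aA bB.
pose T n : R := Num.max u v + n%:R.
apply: (@ccov_limit _ _ _ _ _ _ (fun n : nat => space (past C (T n)))).
  move=> n; apply: separated_past => //;
    by rewrite /T -[X in X <= _]addr0 lerD // le_max lexx ?orbT.
have Tm n m : (n <= m)%N -> space (past C (T n)) `<=` space (past C (T m)).
  by move=> nm; apply: space_mono; apply: past_mono => //; rewrite lerD2l ler_nat.
apply: oproj_increasing => //.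
  by move=> n; apply: space_mono => j [].
apply: space_min; first exact: closed_limit_union.
move=> a' w aC e e0; exists (y a' w); last by rewrite subrr nsq0.
exists (Num.Def.archi_bound `|w - Num.max u v|).
apply: mem_space; split=> //=; rewrite /T -lerBlDl.
by apply: le_trans (ler_norm _) (ltW _); exact: archi_boundP.
Qed.
End Separation.
End PositiveAngle.
End Family.

(** * Vertices reached by m-connecting paths *)

Section Reach.
Context {V : finType} (G : mixed_graph V) (A B C : {set V}).

(** The vertex reached is recorded with the last edge of the path, since that
    edge decides, together with the next one, whether the vertex will be a
    collider; [None] stands for the path without edges. *)
Inductive reach : option edge_kind -> V -> Prop :=
| reach_start a : a \in A -> reach None a
| reach_first a e v : a \in A -> is_edge G e a v -> reach (Some e) v
| reach_step e v e' w : reach (Some e) v ->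
    (if collider e e' then v \in C else v \notin C) ->
    is_edge G e' v w -> reach (Some e') w.

Lemma m_connecting_rcons p e v e' w :
  m_connecting C (rcons p (e, v)) ->
  (if collider e e' then v \in C else v \notin C) ->
  m_connecting C (rcons (rcons p (e, v)) (e', w)).
Proof.
elim: p => [|[e1 v1] p IH] //= h hc.
case: p IH h => [|[e2 v2] p] /= IH; first by case=> h1 _.
by case=> h1 h2; split=> //; exact: IH.
Qed.

Lemma is_path_rcons a p e v : is_path G a p -> is_edge G e (last a (map snd p)) v ->
  is_path G a (rcons p (e, v)).
Proof. by elim: p a => [|[e1 v1] p IH] a //= [h1 h2] h; split=> //; exact: IH. Qed.

Lemma reach_path oe v : reach oe v -> exists a p,
  [/\ a \in A, path_between G a v p, m_connecting C p &
      oe = ohead (rev (map fst p))].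
Proof.
elim=> [a aA|a e {}v aA av|e {}v e' w _ [a [p [aA [ap pv] mp pe]]] hc vw].
- by exists a, [::].
- by exists a, [:: (e, v)].
case/lastP: p ap pv mp pe => [//|p [e1 v1]] ap pv mp.
rewrite map_rcons rev_rcons /= => -[?]; subst e1.
move: pv; rewrite map_rcons last_rcons /= => ?; subst v1.
exists a, (rcons (rcons p (e, v)) (e', w)); split=> //.
- split; last by rewrite map_rcons last_rcons.
  by apply: is_path_rcons => //; rewrite map_rcons last_rcons.
- exact: m_connecting_rcons.
- by rewrite map_rcons rev_rcons.
Qed.

Inductive ancestor : V -> Prop :=
| ancestor_self v : v \in A :|: B :|: C -> ancestor v
| ancestor_step v w : directed G v w -> ancestor w -> ancestor v.

Hypothesis (AC : [disjoint A & C]%B).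
Hypothesis (sep : m_separated G A B C).

Lemma reach_notin oe v : reach oe v -> v \notin B.
Proof.
case/reach_path => a [p [aA ap mp _]]; apply/negP => vB; exact: (sep aA vB ap mp).
Qed.

(** A vertex off [C] at which the path arrives against an arrow, or starts, is a
    non-collider whatever edge follows. *)
Definition open_vertex v := reach None v \/ reach (Some Backward) v.

Lemma open_step v e w : v \notin C -> open_vertex v -> is_edge G e v w ->
  reach (Some e) w.
Proof.
move=> vC [] h vw; last by apply: (reach_step h) vw.
by inversion h; subst; exact: (@reach_first v).
Qed.

(** Repeated vertices are allowed on paths: a path that has entered an ancestor
    off [C] by an arrowhead goes down along arrows to the first descendant in
    [A], [B] or [C].  It cannot meet [B]; at [C] it turns back as at a collider;
    in [A] a new path starts.  In the last two cases the way back up arrives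
    against an arrow. *)
Lemma reach_open v : ancestor v -> v \notin C -> (exists oe, reach oe v) ->
  open_vertex v.
Proof.
elim=> {v} [v vABC|v w vw _ IH] vC [oe rv].
  move: vABC; rewrite !inE (negPf vC) orbF => /orP[vA|vB].
    by left; exact: reach_start.
  by have := reach_notin rv; rewrite vB.
case: oe rv => [e|] rv; last by left.
have rw : reach (Some Forward) w by apply: (@reach_step e v Forward w rv) => //; case: e {rv}.
right; have [wC|wC] := boolP (w \in C); first exact: (@reach_step Forward w Backward v rw).
by apply: (@open_step w); first exact: wC; first by apply: IH => //; exists (Some Forward).
Qed.

Definition anc_set : {set V} := [set v | `[< ancestor v >]].
(** [sideA] enlarges [A] and [sideB] enlarges [B] so that, with [C], they exhaust
    the ancestors; [sideM] and [sideN] distribute the vertices of [C] between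
    them. *)
Definition sideA : {set V} :=
  [set v in anc_set | (v \notin C) && `[< exists oe, reach oe v >]]%SET.
Definition sideM : {set V} := (sideA :|:
  [set v in C | `[< reach (Some Forward) v \/ reach (Some Dashed) v >]])%SET.
Definition sideN : {set V} := (anc_set :\: sideM)%SET.
Definition sideB : {set V} := (anc_set :\: (sideA :|: C))%SET.

Lemma in_anc v : (v \in anc_set) = `[< ancestor v >]. Proof. by rewrite inE. Qed.

Lemma sub_anc v : v \in A :|: B :|: C -> v \in anc_set.
Proof. by move=> vABC; rewrite in_anc; apply/asboolP; exact: ancestor_self. Qed.

Lemma anc_parent v w : directed G v w -> w \in anc_set -> v \in anc_set.
Proof. by rewrite !in_anc => vw /asboolP h; apply/asboolP; apply: ancestor_step vw h. Qed.

Lemma in_sideA v : v \in sideA <->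
  [/\ v \in anc_set, v \notin C & exists oe, reach oe v].
Proof.
by rewrite inE; split=> [/and3P[? ? /asboolP ?]|[? ? h]] //; apply/and3P; split=> //; apply/asboolP.
Qed.

Lemma in_sideM v : v \in sideM <-> v \in sideA \/
  v \in C /\ (reach (Some Forward) v \/ reach (Some Dashed) v).
Proof.
rewrite inE [X in _ || X]inE; split=> [/orP[|/andP[vC /asboolP]]|[->//|[-> h]]]; [by left|by right|].
by apply/orP; right; apply/asboolP.
Qed.

(** A path can be continued from [sideA] by any edge.  A vertex of [C] entered
    against an arrow is excluded, because the path enters it by a tail. *)
Lemma sideA_step v e w : v \in sideA -> w \in anc_set -> is_edge G e v w ->
  (if e is Backward then w \notin C else true) -> w \in sideM.
Proof.
case/in_sideA => vU vC rv wU vw ew; apply/in_sideM.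
have rw : reach (Some e) w.
  by apply: open_step vw => //; apply: reach_open => //; move: vU; rewrite in_anc => /asboolP.
have [wC|wC] := boolP (w \in C); last first.
  by left; apply/in_sideA; split=> //; exists (Some e).
by right; split=> //; case: e vw ew rw; rewrite ?wC //; [left|right].
Qed.

Lemma sideA_child v w : v \in sideA -> w \in anc_set -> directed G v w -> w \in sideM.
Proof. by move=> vA wU vw; exact: (@sideA_step v Forward). Qed.

(** A vertex of [C] in [sideM] is entered by an arrowhead or a dashed edge, hence
    is a collider, and open, when left by a dashed edge; likewise below when it
    is left against an arrow. *)
Lemma sideM_dashed v w : v \in sideM -> w \in anc_set -> dashed G v w -> w \in sideM.
Proof.
move=> /in_sideM[vA|[vC rv]] wU vw; first exact: (@sideA_step v Dashed).
have rw : reach (Some Dashed) w by case: rv => rv; apply: (@reach_step _ v Dashed w rv).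
apply/in_sideM; have [wC|wC] := boolP (w \in C); first by right; split=> //; right.
by left; apply/in_sideA; split=> //; exists (Some Dashed).
Qed.

Lemma sideM_parent v w : w \in sideM -> v \in anc_set -> v \notin C ->
  directed G v w -> v \in sideA.
Proof.
move=> /in_sideM[wA|[wC rw]] vU vC vw.
  have /in_sideM[//|[]] := @sideA_step w Backward v wA vU vw vC.
  by rewrite (negPf vC).
apply/in_sideA; split=> //; exists (Some Backward).
by case: rw => rw; apply: (@reach_step _ w Backward v rw).
Qed.

Hypothesis BC : [disjoint B & C]%B.

Lemma sub_sideA : A \subset sideA.
Proof.
apply/fintype.subsetP => a aA; apply/in_sideA; split.
- by apply: sub_anc; rewrite !inE aA.
- by rewrite (disjointFr AC).
- by exists None; exact: reach_start.
Qed.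

Lemma sub_sideB : B \subset sideB.
Proof.
apply/fintype.subsetP => b bB; have bC : b \notin C by rewrite (disjointFr BC).
rewrite finset.in_setD finset.in_setU (negPf bC) orbF sub_anc ?andbT; last by rewrite !inE bB orbT.
by apply/negP => /in_sideA[_ _ [oe /reach_notin]]; rewrite bB.
Qed.

Lemma sub_sideA_sideM : sideA \subset sideM.
Proof. exact: finset.subsetUl. Qed.

Lemma sub_sideM_anc : sideM \subset anc_set.
Proof.
apply/fintype.subsetP => v /in_sideM[/in_sideA[]//|[vC _]].
by apply: sub_anc; rewrite !inE vC orbT.
Qed.

Lemma sideM_subset : sideM \subset sideA :|: C.
Proof.
by apply/fintype.subsetP => v /in_sideM[vA|[vC _]]; rewrite inE ?vA ?vC ?orbT.
Qed.

Lemma sideB_sideN : sideB \subset sideN.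
Proof. by apply: finset.setDS; exact: sideM_subset. Qed.

Lemma C_subset : C \subset sideM :|: sideN.
Proof.
apply/fintype.subsetP => v vC; rewrite finset.in_setU finset.in_setD sub_anc ?andbT ?orbN //.
by rewrite !inE vC orbT.
Qed.

Lemma sideN_subset : sideN \subset sideB :|: C.
Proof.
apply/fintype.subsetP => v.
rewrite !finset.in_setD finset.in_setU finset.in_setD finset.in_setU => /andP[vM vU].
have [vC|vC] := boolP (v \in C); first by rewrite orbT.
rewrite !orbF vU andbT; apply: contra vM; exact: (fintype.subsetP sub_sideA_sideM).
Qed.

Lemma no_edge_into_M v w : v \notin sideA :|: C -> w \in sideM ->
  ~ directed G v w.
Proof.
rewrite finset.in_setU negb_or => /andP[vA vC] wM vw; move/negP: vA; apply.
apply: (sideM_parent wM) => //; apply: (anc_parent vw).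
exact: (fintype.subsetP sub_sideM_anc).
Qed.

Lemma no_edge_into_N v w : v \notin sideB :|: C -> w \in sideN ->
  ~ directed G v w.
Proof.
rewrite finset.in_setU negb_or finset.in_setD finset.in_setU negb_and !negb_or => /andP[+ vC].
rewrite finset.in_setD => h /andP[wM wU] vw; move/negP: wM; apply.
move: h; rewrite negb_and negbK (negPf vC) orbF (anc_parent vw wU) orbF => vA.
exact: sideA_child vA wU vw.
Qed.

Lemma no_dashed_MN v w : v \in sideM -> w \in sideN -> ~ dashed G v w.
Proof.
rewrite finset.in_setD => vM /andP[wM wU] vw; move/negP: wM; apply.
exact: sideM_dashed vM wU vw.
Qed.
End Reach.

(** * Integration of complex-valued functions *)

Section ComplexIntegral.
Context {R : realType} d (T : measurableType d) (mu : {measure set T -> \bar R}).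
Implicit Types (f g : T -> R[i]) (c : R[i]).

Lemma ReM (z w : R[i]) : complex.Re (z * w) =
  complex.Re z * complex.Re w - complex.Im z * complex.Im w.
Proof. by case: z w => [? ?] [? ?]. Qed.
Lemma ImM (z w : R[i]) : complex.Im (z * w) =
  complex.Re z * complex.Im w + complex.Im z * complex.Re w.
Proof. by case: z w => [? ?] [? ?]. Qed.
Lemma ImD (z w : R[i]) : complex.Im (z + w) = complex.Im z + complex.Im w.
Proof. by case: z w => [? ?] [? ?]. Qed.
Lemma ImN (z : R[i]) : complex.Im (- z) = - complex.Im z.
Proof. by case: z. Qed.
Lemma Im_conj (z : R[i]) : complex.Im z^* = - complex.Im z.
Proof. by case: z. Qed.

Lemma cintegrableD f g : cintegrable mu f -> cintegrable mu g ->
  cintegrable mu (fun x => f x + g x).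
Proof.
move=> [f1 f2] [g1 g2]; split.
- apply: eq_integrable (integrableD measurableT f1 g1) => // x _ /=.
  by rewrite ReD EFinD.
- apply: eq_integrable (integrableD measurableT f2 g2) => // x _ /=.
  by rewrite ImD EFinD.
Qed.

Lemma cintegralD f g : cintegrable mu f -> cintegrable mu g ->
  cintegral mu (fun x => f x + g x) = cintegral mu f + cintegral mu g.
Proof.
move=> [f1 f2] [g1 g2]; rewrite /cintegral.
under eq_Rintegral do rewrite ReD.
under [X in Complex _ X]eq_Rintegral do rewrite ImD.
by rewrite !RintegralD.
Qed.

Lemma integrable_lin (a b : R) (f g : T -> R) : mu.-integrable setT (EFin \o f) ->
  mu.-integrable setT (EFin \o g) ->
  mu.-integrable setT (EFin \o (fun x => a * f x + b * g x)).
Proof.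
move=> hf hg; apply: eq_integrable (integrableD measurableT
  (integrableZl measurableT a hf) (integrableZl measurableT b hg)) => //.
Qed.

Lemma Rintegral_lin (a b : R) (f g : T -> R) : mu.-integrable setT (EFin \o f) ->
  mu.-integrable setT (EFin \o g) ->
  \int[mu]_x (a * f x + b * g x) = a * \int[mu]_x f x + b * \int[mu]_x g x.
Proof.
move=> hf hg; have hf' := integrableZl measurableT a hf.
by have hg' := integrableZl measurableT b hg; rewrite RintegralD ?RintegralZl.
Qed.

Lemma cintegrableZ c f : cintegrable mu f -> cintegrable mu (fun x => c * f x).
Proof.
move=> [f1 f2]; split.
- apply: eq_integrable (integrable_lin (complex.Re c) (- complex.Im c) f1 f2) => // x _ /=.
  by rewrite ReM mulNr.
- apply: eq_integrable (integrable_lin (complex.Re c) (complex.Im c) f2 f1) => // x _ /=.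
  by rewrite ImM.
Qed.

Lemma cintegralZ c f : cintegrable mu f ->
  cintegral mu (fun x => c * f x) = c * cintegral mu f.
Proof.
move=> [f1 f2]; rewrite /cintegral.
under eq_Rintegral do rewrite ReM -mulNr.
under [X in Complex _ X]eq_Rintegral do rewrite ImM.
rewrite !Rintegral_lin //; apply/eqP; rewrite eq_complex ReM ImM /=.
by rewrite mulNr !eqxx.
Qed.

Lemma cintegral_conj f : cintegrable mu f ->
  cintegral mu (fun x => (f x)^*) = (cintegral mu f)^*.
Proof.
move=> [f1 f2]; rewrite /cintegral.
under eq_Rintegral do rewrite Re_conj.
under [X in Complex _ X]eq_Rintegral do rewrite Im_conj -mulN1r.
by rewrite RintegralZl // mulN1r.
Qed.

Lemma cintegrable0 : cintegrable mu (fun=> 0).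
Proof. by split; exact: integrable0. Qed.

Lemma cintegral0 : cintegral mu (fun=> 0) = 0.
Proof. by rewrite /cintegral /= /Rintegral integral0. Qed.

Lemma cintegrable_sum (I : Type) (r : seq I) (F : I -> T -> R[i]) :
  (forall i, cintegrable mu (F i)) -> cintegrable mu (fun x => \sum_(i <- r) F i x).
Proof.
move=> hF; elim: r => [|i r IH].
  by under eq_fun do rewrite big_nil; exact: cintegrable0.
by under eq_fun do rewrite big_cons; exact: cintegrableD.
Qed.

Lemma cintegral_sum (I : Type) (r : seq I) (F : I -> T -> R[i]) :
  (forall i, cintegrable mu (F i)) ->
  cintegral mu (fun x => \sum_(i <- r) F i x) = \sum_(i <- r) cintegral mu (F i).
Proof.
move=> hF; elim: r => [|i r IH].
  by under eq_fun do rewrite big_nil; rewrite cintegral0 big_nil.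
under eq_fun do rewrite big_cons.
by rewrite cintegralD ?IH ?big_cons //; exact: cintegrable_sum.
Qed.
End ComplexIntegral.

(** * Completeness of square-integrable functions *)

Section RieszFischer.
Context {R : realType} d (T : measurableType d) (mu : {measure set T -> \bar R}).
Local Notation L2R := (Lfun mu 2%:E).

Lemma Lfun_measurable (f : T -> R) : f \in L2R -> measurable_fun setT f.
Proof. by move=> /andP[/[!inE]]. Qed.

Lemma Lfun2_lin (a b : R) (f g : T -> R) : f \in L2R -> g \in L2R ->
  (fun x => a * f x + b * g x) \in L2R.
Proof.
move=> hf hg; have [h0 h] := Lfun_submod_closed mu (lee1n 2).
by have := h a f _ hf (h b g 0 hg h0); rewrite addr0.
Qed.

Lemma Lfun2B (f g : T -> R) : f \in L2R -> g \in L2R ->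
  (fun x => f x - g x) \in L2R.
Proof.
move=> hf hg; have := Lfun2_lin 1 (-1) hf hg.
by under eq_fun do rewrite mul1r mulN1r.
Qed.

Lemma Lfun2_sqr (f : T -> R) : measurable_fun setT f ->
  (\int[mu]_x ((f x) ^+ 2)%:E < +oo)%E -> f \in L2R.
Proof.
move=> mf hf; apply/andP; split; rewrite inE //=.
rewrite /finite_norm unlock /Lnorm poweR_lty //.
by under eq_integral do rewrite /= powR_mulrn ?normr_ge0 // real_normK ?num_real //.
Qed.

Lemma EFin_Rintegral_sqr (f : T -> R) : f \in L2R ->
  (\int[mu]_x (f x ^+ 2))%:E = (\int[mu]_x (f x ^+ 2)%:E)%E.
Proof.
by move=> /Lfun2_integrable_sqr h; rewrite /Rintegral fineK //; exact: integrable_fin_num.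
Qed.

Lemma limn_einf_le (a : (\bar R)^nat) (e : \bar R) K :
  (forall k, (K <= k)%N -> (a k <= e)%E) -> (limn_einf a <= e)%E.
Proof.
move=> h; rewrite limn_einf_lim; apply: lime_le; first exact: is_cvg_einfs.
apply: nearW => n; apply: le_trans (h (maxn n K) (leq_maxr _ _)).
by apply: ereal_inf_lbound; exists (maxn n K) => //=; exact: leq_maxl.
Qed.

(** The increments decay like [2 ^- k], hence are summable. *)
Lemma sqr_sum_cvg (v : nat -> R) (M : R) :
  (forall k, 4 ^+ k * (v k.+1 - v k) ^+ 2 <= M) -> cvgn v.
Proof.
move=> h; have M0 : 0 <= M by apply: le_trans (h 0%N); rewrite mulr_ge0 ?sqr_ge0.
have dv k : `|v k.+1 - v k| <= geometric (Num.sqrt M) (2^-1) k.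
  rewrite /geometric /= -(@ler_pXn2r _ 2) ?nnegrE ?mulr_ge0 ?sqrtr_ge0 ?exprn_ge0 //.
  rewrite real_normK ?num_real // exprMn sqr_sqrtr // -exprM mulnC exprM.
  have -> : (2^-1 : R) ^+ 2 = 4^-1 by rewrite exprVn; congr (_^-1); ring.
  by rewrite exprVn ler_pdivlMr ?exprn_gt0 // mulrC.
have cs : cvgn (series (fun k => v k.+1 - v k)).
  apply: normed_cvg; apply: (series_le_cvg _ _ dv).
  - by move=> k; exact: normr_ge0.
  - by move=> k; rewrite /geometric /= mulr_ge0 ?sqrtr_ge0 ?exprn_ge0.
  - by apply: is_cvg_geometric_series; rewrite ger0_norm ?invf_lt1 ?ltr1n.
have -> : v = (fun k => v 0%N + series (fun k => v k.+1 - v k) k).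
  by apply/funext => k; rewrite /series /= telescope_sumr // addrC subrK.
by apply: is_cvgD => //; exact: is_cvg_cst.
Qed.

(** A fast Cauchy subsequence [v] has [4 ^ k * (v k.+1 - v k) ^ 2] summable in
    mean, hence summable almost everywhere, which forces [v] to converge there;
    Fatou's lemma transfers the Cauchy estimate to the limit. *)
Lemma riesz_fischer (u : nat -> T -> R) : (forall n, u n \in L2R) ->
  (forall e : R, 0 < e -> exists n, forall m, (n <= m)%N ->
    \int[mu]_x ((u m x - u n x) ^+ 2) < e) ->
  exists2 l, l \in L2R & forall e : R, 0 < e -> exists n, forall m, (n <= m)%N ->
    \int[mu]_x ((u m x - l x) ^+ 2) < e.
Proof.
move=> uL uC.
have uB n m : (fun x => u n x - u m x) \in L2R by exact: Lfun2B.
have uC2 (e : R) : 0 < e -> exists n, forall m p, (n <= m)%N -> (n <= p)%N ->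
    \int[mu]_x ((u m x - u p x) ^+ 2) < e.
  move=> e0; have [|n hn] := uC (e / 4); first by lra.
  exists n => m p nm np.
  apply: (@le_lt_trans _ _ (\int[mu]_x (2 * (u m x - u n x) ^+ 2 + 2 * (u p x - u n x) ^+ 2))).
    apply: le_Rintegral => //; first exact: Lfun2_integrable_sqr.
      by apply: integrable_lin; exact: Lfun2_integrable_sqr.
    move=> x _; have := sqr_ge0 (u m x - u n x + (u p x - u n x)).
    by rewrite !expr2; lra.
  rewrite Rintegral_lin; try exact: Lfun2_integrable_sqr.
  have := hn m nm; have := hn p np; lra.
have /choice[f fP] : forall k : nat, exists n, forall m p, (n <= m)%N -> (n <= p)%N ->
    \int[mu]_x ((u m x - u p x) ^+ 2) < (4 ^+ k)^-1 * (1 / (2 ^ k.+1)%:R).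
  move=> k; apply: uC2.
  by rewrite mulr_gt0 ?divr_gt0 ?invr_gt0 ?exprn_gt0 ?ltr0n ?expn_gt0.
(* [n_ k] dominates both [f k] and [k], and increases with [k]. *)
pose n_ k := (\sum_(i < k.+1) (f i + 1))%N.
have fn k : (f k <= n_ k)%N by rewrite /n_ big_ord_recr /= addnCA leq_addr.
have kn k : (k <= n_ k)%N.
  by rewrite /n_ big_split /= sum1_card card_ord; apply: leq_trans (leqnSn k) (leq_addl _ _).
have nS k : (n_ k <= n_ k.+1)%N by rewrite [n_ k.+1]/n_ big_ord_recr leq_addr.
pose v k := u (n_ k).
have mu_ n : measurable_fun setT (u n) by exact: Lfun_measurable.
pose G : (T -> \bar R)^nat := fun k x => (4 ^+ k * (v k.+1 x - v k x) ^+ 2)%:E.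
have G0 k x : (0 <= G k x)%E by rewrite lee_fin mulr_ge0 ?sqr_ge0 ?exprn_ge0.
have mG k : measurable_fun setT (G k).
  apply/measurable_EFinP; apply: measurable_funM; first exact: measurable_cst.
  by apply: measurable_funX; apply: measurable_funB; exact: mu_.
have iG : (\int[mu]_x (\sum_(k <oo) G k x) < +oo)%E.
  rewrite integral_nneseries //; apply: (@le_lt_trans _ _ 1%:E); last exact: ltry.
  apply: le_trans (epsilon_trick0 xpredT ler01); apply: lee_nneseries.
    by move=> k _ _; apply: integral_ge0.
  move=> k _; rewrite /G; under eq_integral do rewrite EFinM.
  rewrite integralZl //; last exact: (Lfun2_integrable_sqr (uB _ _)).
  rewrite -EFin_Rintegral_sqr ?uB // -EFinM lee_fin -ler_pdivlMl ?exprn_gt0 //.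
  by apply/ltW/fP => //; exact: leq_trans (fn k) (nS k).
have [N [mN N0 GN]] : {ae mu, forall x, setT x -> (\sum_(k <oo) G k x)%E \is a fin_num}.
  apply: integrable_ae => //; apply/integrableP; split.
    apply: ge0_emeasurable_sum => //.
  by under eq_integral do rewrite gee0_abs ?nneseries_ge0 //.
pose E := ~` N; have mE : measurable E by exact: measurableC.
have cv x : E x -> cvgn (v^~ x).
  move=> Ex; have fx : (\sum_(k <oo) G k x)%E \is a fin_num.
    by apply: contrapT => h; apply: Ex; apply: GN => /= /(_ I).
  apply: (@sqr_sum_cvg _ (fine (\sum_(k <oo) G k x)%E)) => k.
  rewrite -lee_fin fineK //; apply: le_trans (nneseries_lim_ge k.+1 _) => //.
  by rewrite big_nat_recr //= leeDr // sume_ge0.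
(* Cutting off outside [E] makes the limit exist everywhere, hence measurable. *)
pose h k x := v k x * \1_E x; pose l x := limn (h^~ x).
have hE x : E x -> h^~ x = v^~ x.
  by move=> Ex; apply/funext => k; rewrite /h indicE mem_set // mulr1.
have hl x : h^~ x @ \oo --> l x.
  rewrite /l; have [Ex|nEx] := pselect (E x); first by rewrite hE //; exact: cv.
  have -> : h^~ x = cst 0; last exact: is_cvg_cst.
  by apply/funext => k; rewrite /h indicE memNset // mulr0.
have mh k : measurable_fun setT (h k).
  by apply: measurable_funM; [exact: mu_|exact: measurable_indic].
have ml : measurable_fun setT l.
  by apply: (measurable_fun_cvg mh) => x _; exact: hl.
have msq m (g : T -> R) : measurable_fun setT g ->
    measurable_fun setT (fun x => ((u m x - g x) ^+ 2)%:E).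
  move=> mg; apply/measurable_EFinP; apply: measurable_funX.
  by apply: measurable_funB => //; exact: mu_.
have key (e : R) : 0 < e -> exists n, forall m, (n <= m)%N ->
    (\int[mu]_x ((u m x - l x) ^+ 2)%:E <= e%:E)%E.
  move=> e0; have [n hn] := uC2 e e0; exists n => m nm.
  rewrite (ge0_negligible_integral mN) //; last 2 first.
  - exact: msq.
  - by move=> x _; rewrite lee_fin sqr_ge0.
  rewrite setTD -/E.
  rewrite (eq_integral (fun x => limn_einf (fun k => ((u m x - v k x) ^+ 2)%:E))); last first.
    move=> x /set_mem Ex; apply/esym.
    apply: (@cvg_limn_einf_sup _ _ ((u m x - l x) ^+ 2)%:E _).1.
    apply: cvg_EFin; first exact: nearW.
    have := hl x; rewrite hE // => vl.
    have ul : (fun k => u m x - v k x) @ \oo --> u m x - l x by apply: cvgB => //; exact: cvg_cst.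
    exact: (cvgM ul ul).
  apply: le_trans (fatou mu mE _ _) _.
  - by move=> k; apply: (measurable_funS measurableT _ (msq m (v k) (mu_ _))).
  - by move=> k x _; rewrite lee_fin sqr_ge0.
  apply: (@limn_einf_le _ _ n) => k nk.
  apply: (@le_trans _ _ (\int[mu]_x ((u m x - v k x) ^+ 2)%:E)%E).
    apply: ge0_subset_integral => //; first exact: (msq _ _ (mu_ _)).
    by move=> x _; rewrite lee_fin sqr_ge0.
  rewrite -EFin_Rintegral_sqr ?uB // lee_fin; apply/ltW/hn => //.
  exact: leq_trans nk (kn k).
have [n0 hn0] := key 1 ltr01.
have lL : l \in L2R.
  have -> : l = (fun x => u n0 x - (u n0 x - l x)).
    by apply/funext => x; rewrite opprB addrC subrK.
  apply: Lfun2B => //; apply: Lfun2_sqr; last exact: le_lt_trans (hn0 n0 (leqnn _)) (ltry _).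
  by apply: measurable_funB => //; exact: mu_.
exists l => // e e0; have [|n hn] := key (e / 2); first by lra.
exists n => m nm; rewrite -lte_fin EFin_Rintegral_sqr; last exact: Lfun2B.
by apply: le_lt_trans (hn m nm) _; rewrite lte_fin; lra.
Qed.
End RieszFischer.

(** * The Hilbert space of square-integrable random variables *)

Section L2space.
Context {R : realType} d (T : measurableType d) (P : probability T R).

Definition sqint_pred : {pred (T -> R[i])} := fun X => `[< sqint P X >].

Fact sqint_submod_closed : submod_closed sqint_pred.
Proof.
split=> [|c X Y]; rewrite !unfold_in.
  by apply/asboolP; split; case: (Lfun_submod_closed P (lee1n 2)).
move=> /asboolP[X1 X2] /asboolP[Y1 Y2]; apply/asboolP; split.
- rewrite (_ : (fun w => _) = (fun w => 1 * (complex.Re c * complex.Re (X w) +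
      - complex.Im c * complex.Im (X w)) + 1 * complex.Re (Y w))).
    by apply: Lfun2_lin => //; exact: Lfun2_lin.
  by apply/funext => x; rewrite !mul1r ReD ReM mulNr.
- rewrite (_ : (fun w => _) = (fun w => 1 * (complex.Re c * complex.Im (X w) +
      complex.Im c * complex.Re (X w)) + 1 * complex.Im (Y w))).
    by apply: Lfun2_lin => //; exact: Lfun2_lin.
  by apply/funext => x; rewrite !mul1r ImD ImM.
Qed.

HB.instance Definition _ :=
  GRing.isSubmodClosed.Build _ _ sqint_pred sqint_submod_closed.

(** Square-integrable functions themselves, not their classes modulo almost sure
    equality. *)
Record L2 := MkL2 { L2fun : T -> R[i]; L2P : L2fun \in sqint_pred }.
HB.instance Definition _ := [isSub for L2fun].
HB.instance Definition _ := [Choice of L2 by <:].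
HB.instance Definition _ := [SubChoice_isSubLmodule of L2 by <:].

Lemma sqintE X : X \in sqint_pred <-> sqint P X.
Proof. by rewrite unfold_in; split=> /asboolP. Qed.

Lemma sqint_cintegrable X Y : sqint P X -> sqint P Y ->
  cintegrable P (fun w => X w * (Y w)^*).
Proof.
move=> [X1 X2] [Y1 Y2].
have i f g : f \in Lfun P 2%:E -> g \in Lfun P 2%:E ->
    P.-integrable setT (EFin \o (f \* g)).
  by move=> hf hg; apply/Lfun1_integrable; exact: Lfun2_mul_Lfun1.
split.
- apply: eq_integrable (integrable_lin 1 1 (i _ _ X1 Y1) (i _ _ X2 Y2)) => // x _ /=.
  by rewrite !mul1r ReM Re_conj Im_conj mulrN opprK.
- apply: eq_integrable (integrable_lin 1 (-1) (i _ _ X2 Y1) (i _ _ X1 Y2)) => // x _ /=.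
  by rewrite mul1r mulN1r ImM Re_conj Im_conj mulrN addrC.
Qed.

Definition L2inner (X Y : L2) : R[i] := inner P (L2fun X) (L2fun Y).

Lemma L2_sqint (X : L2) : sqint P (L2fun X).
Proof. exact/sqintE/L2P. Qed.

Lemma L2innerDl X Y Z : L2inner (X + Y) Z = L2inner X Z + L2inner Y Z.
Proof.
rewrite /L2inner /inner -cintegralD; try by apply: sqint_cintegrable; exact: L2_sqint.
by congr cintegral; apply/funext => w; rewrite -mulrDl.
Qed.

Lemma L2innerZl c X Z : L2inner (c *: X) Z = c * L2inner X Z.
Proof.
rewrite /L2inner /inner -cintegralZ; last by apply: sqint_cintegrable; exact: L2_sqint.
by congr cintegral; apply/funext => w; rewrite mulrA.
Qed.

Lemma L2innerC X Y : L2inner Y X = (L2inner X Y)^*.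
Proof.
rewrite /L2inner /inner -cintegral_conj; last by apply: sqint_cintegrable; exact: L2_sqint.
by congr cintegral; apply/funext => w; rewrite rmorphM /= conjCK mulrC.
Qed.

Lemma Re_L2inner X : complex.Re (L2inner X X) =
  \int[P]_w (complex.Re (L2fun X w) ^+ 2 + complex.Im (L2fun X w) ^+ 2).
Proof. by rewrite /L2inner /inner /=; apply: eq_Rintegral => w _; rewrite sqr_conj_Re. Qed.

Lemma L2inner_ge0 X : 0 <= complex.Re (L2inner X X).
Proof. by rewrite Re_L2inner; apply: Rintegral_ge0 => w _; rewrite addr_ge0 ?sqr_ge0. Qed.

Lemma L2_complete (u : nat -> L2) :
  (forall e : R, 0 < e -> exists n, forall m, (n <= m)%N ->
     complex.Re (L2inner (u m - u n) (u m - u n)) < e) ->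
  exists l, forall e : R, 0 < e -> exists n, forall m, (n <= m)%N ->
     complex.Re (L2inner (u m - l) (u m - l)) < e.
Proof.
pose re (X : L2) w := complex.Re (L2fun X w).
pose im (X : L2) w := complex.Im (L2fun X w).
have reL X : re X \in Lfun P 2%:E by case: (L2_sqint X).
have imL X : im X \in Lfun P 2%:E by case: (L2_sqint X).
have reB X Y w : re (X - Y) w = re X w - re Y w by rewrite /re ReD ReN.
have imB X Y w : im (X - Y) w = im X w - im Y w by rewrite /im ImD ImN.
have i2 X : P.-integrable setT (EFin \o (fun w => re X w ^+ 2 + im X w ^+ 2)).
  apply: eq_integrable (integrable_lin 1 1 (Lfun2_integrable_sqr (reL X))
    (Lfun2_integrable_sqr (imL X))) => // x _ /=; by rewrite !mul1r.
move=> uC.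
have [|lr lrL lrP] := @riesz_fischer _ _ _ P (fun n => re (u n)) (fun n => reL _).
  move=> e /uC[n hn]; exists n => m /hn; apply: le_lt_trans; rewrite Re_L2inner.
  under eq_Rintegral do rewrite -reB.
  apply: le_Rintegral => //; first exact: Lfun2_integrable_sqr.
    exact: (i2 (u m - u n)).
  by move=> x _; rewrite lerDl sqr_ge0.
have [|li liL liP] := @riesz_fischer _ _ _ P (fun n => im (u n)) (fun n => imL _).
  move=> e /uC[n hn]; exists n => m /hn; apply: le_lt_trans; rewrite Re_L2inner.
  under eq_Rintegral do rewrite -imB.
  apply: le_Rintegral => //; first exact: Lfun2_integrable_sqr.
    exact: (i2 (u m - u n)).
  by move=> x _; rewrite lerDr sqr_ge0.
have lP : (fun w => Complex (lr w) (li w)) \in sqint_pred by apply/sqintE.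
exists (MkL2 lP) => e e0; have [|n hn] := lrP (e / 2); first by lra.
have [|m hm] := liP (e / 2); first by lra.
exists (maxn n m) => p; rewrite geq_max => /andP[/hn hr /hm hi].
rewrite Re_L2inner.
under eq_Rintegral do rewrite -/(re _ _) -/(im _ _) reB imB -[X in X + _]mul1r -[X in _ + X]mul1r.
rewrite Rintegral_lin ?mul1r; [|exact: Lfun2_integrable_sqr (Lfun2B (reL _) lrL)|
  exact: Lfun2_integrable_sqr (Lfun2B (imL _) liL)].
by rewrite [X in _ < X]splitr ltrD.
Qed.

Definition L2form : hilbert_form L2 :=
  HilbertForm L2innerDl L2innerZl L2innerC L2inner_ge0 L2_complete.

End L2space.

(** * The Schur complement bound *)

Section Schur.
Context {C : numClosedFieldType}.

Lemma adjmxM m n p (A : 'M[C]_(m, n)) (B : 'M[C]_(n, p)) :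
  (A *m B)^t* = B^t* *m A^t*.
Proof. by rewrite trmx_mul map_mxM. Qed.

Lemma adjmxD m n (A B : 'M[C]_(m, n)) : (A + B)^t* = A^t* + B^t*.
Proof. by rewrite linearD /= map_mxD. Qed.

Lemma posdefmx_herm n (M : 'M[C]_n) : posdefmx M -> M^t* = M.
Proof. by case=> /is_hermitianmxP + _; rewrite expr0 scale1r => <-. Qed.

Lemma posdefmx_unit n (M : 'M[C]_n) : posdefmx M -> M \in unitmx.
Proof.
case=> _ Mp; rewrite -row_free_unit; apply: inj_row_free => v vM.
by apply/eqP; apply: contraT => /Mp; rewrite vM mul0mx mxE ltxx.
Qed.

Lemma posdefmx_ge0 n (M : 'M[C]_n) (v : 'rV_n) : posdefmx M ->
  0 <= (v *m M *m v^t*) 0 0.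
Proof.
case=> _ Mp; have [->|/Mp/ltW//] := eqVneq v 0.
by rewrite !mul0mx mxE.
Qed.

(** Rows of the identity: multiplication selects coordinates, and blocks become
    products. *)
Definition selmx n (A : {set 'I_n}) : 'M[C]_(#|A|, n) :=
  \matrix_(i, j) (enum_val i == j)%:R.

Lemma mul_selmx n p (A : {set 'I_n}) (N : 'M[C]_(n, p)) i j :
  (selmx A *m N) i j = N (enum_val i) j.
Proof.
rewrite mxE (bigD1 (enum_val i)) //= mxE eqxx mul1r big1 ?addr0 // => l li.
by rewrite mxE eq_sym (negPf li) mul0r.
Qed.

Lemma mul_adj_selmx n p (A : {set 'I_n}) (N : 'M[C]_(p, n)) i j :
  (N *m (selmx A)^t*) i j = N i (enum_val j).
Proof.
rewrite mxE (bigD1 (enum_val j)) //= !mxE eqxx rmorph1 mulr1 big1 ?addr0 // => l li.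
by rewrite !mxE eq_sym (negPf li) rmorph0 mulr0.
Qed.

Lemma blockmxE n (A B : {set 'I_n}) (M : 'M[C]_n) :
  blockmx A B M = selmx A *m M *m (selmx B)^t*.
Proof. by apply/matrixP => i j; rewrite mul_adj_selmx mul_selmx mxE. Qed.

Lemma selmx_supp n (A : {set 'I_n}) (X : 'rV[C]_n) :
  (forall j, j \notin A -> X 0 j = 0) -> X *m (selmx A)^t* *m selmx A = X.
Proof.
move=> XA; apply/rowP => j; rewrite mxE.
under eq_bigr do rewrite mul_adj_selmx mxE.
rewrite -(big_enum_val (fun a => X 0 a * (a == j)%:R) (A := mem A)) /=.
have [jA|jA] := boolP (j \in A); last first.
  rewrite (XA _ jA) big1 // => i iA; case: eqVneq => [ij|_]; last by rewrite mulr0.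
  by rewrite -ij iA in jA.
rewrite (bigD1 j) //= eqxx mulr1 big1 ?addr0 // => i /andP[_ ij].
by rewrite (negPf ij) mulr0.
Qed.

Lemma selmx_free n (A : {set 'I_n}) (v : 'rV[C]_#|A|) : v *m selmx A = 0 -> v = 0.
Proof.
move=> v0; apply/rowP => i; have /rowP/(_ (enum_val i)) := v0.
rewrite !mxE (bigD1 i) //= mxE eqxx mulr1 big1 ?addr0 // => j ji.
by rewrite mxE (inj_eq enum_val_inj) (negPf ji) mulr0.
Qed.

Lemma blockmx_posdef n (A : {set 'I_n}) (M : 'M[C]_n) :
  posdefmx M -> posdefmx (blockmx A A M).
Proof.
move=> Mp; have Mh := posdefmx_herm Mp; split.
  apply/is_hermitianmxP; rewrite expr0 scale1r blockmxE !adjmxM trmxCK Mh.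
  by rewrite mulmxA.
move=> v v0; rewrite blockmxE.
have -> : v *m (selmx A *m M *m (selmx A)^t*) *m v^t* =
    (v *m selmx A) *m M *m (v *m selmx A)^t* by rewrite adjmxM !mulmxA.
by apply: Mp.2; apply: contra v0 => /eqP/selmx_free ->.
Qed.

Lemma complete_square p q (F : 'M[C]_q) (G : 'M[C]_(p, q)) (x : 'rV_p) (z : 'rV_q) :
  F^t* = F -> F \in unitmx ->
  (z + x *m G *m invmx F) *m F *m (z + x *m G *m invmx F)^t* =
  z *m F *m z^t* + z *m G^t* *m x^t* + x *m G *m z^t*
    + x *m G *m invmx F *m G^t* *m x^t*.
Proof.
move=> Fh Fu; have FVh : (invmx F)^t* = invmx F by rewrite trmx_inv map_invmx Fh.
rewrite adjmxD !adjmxM FVh mulmxDl mulmxKV //.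
rewrite mulmxDl !mulmxDr !mulmxA mulmxK // -!addrA; congr (_ + _).
Qed.

(** Minimizing the form over [Z] leaves the Schur complement of the block of [A],
    which is at least [eps] times that block: the hypothesis says so after
    multiplication by the inverse square root on both sides, which is undone by
    evaluating it at [v] with [v *m M = x]. *)
Lemma schur_bound n (f : 'M[C]_n) (A B : {set 'I_n}) (eps : C) (X Z : 'rV[C]_n) :
  posdefmx f ->
  possemidefmx ((1 - eps)%:M - invsqrtmx (blockmx A A f) *m blockmx A B f
     *m invmx (blockmx B B f) *m blockmx B A f *m invsqrtmx (blockmx A A f)) ->
  (forall j, j \notin A -> X 0 j = 0) -> (forall j, j \notin B -> Z 0 j = 0) ->
  eps * (X *m f *m X^t*) 0 0 <= ((X + Z) *m f *m (X + Z)^t*) 0 0.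
Proof.
move=> fp [_ psd] /selmx_supp XA /selmx_supp ZB.
have fh := posdefmx_herm fp.
set x := X *m _ in XA; set z := Z *m _ in ZB.
set fAA := blockmx A A f in psd; set fAB := blockmx A B f in psd.
set fBB := blockmx B B f in psd; set fBA := blockmx B A f in psd.
have fAAp : posdefmx fAA by exact: blockmx_posdef.
have fBBp : posdefmx fBB by exact: blockmx_posdef.
have Mh := posdefmx_herm (invsqrtmx_posdef fAAp).
have MfM : invsqrtmx fAA *m fAA *m invsqrtmx fAA = 1%:M.
  by apply: mulmx1C; rewrite mulmxA; exact: invsqrtmxK.
move: (invsqrtmx fAA) psd Mh MfM => M psd Mh MfM.
have [v vM] : exists v, v *m M = x.
  by exists (x *m M *m fAA); rewrite -2!(mulmxA x) MfM mulmx1.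
have Mv : M *m v^t* = x^t* by rewrite -vM adjmxM Mh.
have := psd v.
have -> : v *m ((1 - eps)%:M - M *m fAB *m invmx fBB *m fBA *m M) *m v^t* =
    (1 - eps) *: (v *m v^t*) - x *m fAB *m invmx fBB *m fBA *m x^t*.
  rewrite mulmxBr mulmxBl mul_mx_scalar -scalemxAl; congr (_ - _).
  by rewrite -Mv -vM !mulmxA.
have -> : v *m v^t* = x *m fAA *m x^t*.
  have vE : v *m M *m fAA *m M = v by rewrite -2!(mulmxA v) MfM mulmx1.
  by rewrite -Mv -[X in X *m fAA]vM [RHS]mulmxA vE.
have fBBh := posdefmx_herm fBBp; have fBBu := posdefmx_unit fBBp.
have fABh : fAB^t* = fBA by rewrite /fAB /fBA !blockmxE !adjmxM trmxCK fh mulmxA.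
have := posdefmx_ge0 (z + x *m fAB *m invmx fBB) fBBp.
rewrite complete_square // fABh.
have -> : X *m f *m X^t* = x *m fAA *m x^t*.
  by rewrite -[in LHS]XA /fAA blockmxE !adjmxM !mulmxA.
have -> : (X + Z) *m f *m (X + Z)^t* = x *m fAA *m x^t* + x *m fAB *m z^t*
    + z *m fBA *m x^t* + z *m fBB *m z^t*.
  rewrite -[in LHS]XA -[in LHS]ZB /fAA /fAB /fBA /fBB !blockmxE adjmxD !adjmxM.
  by rewrite !mulmxDl !mulmxDr !mulmxA !addrA.
have eD (U W : 'M[C]_1) : (U + W) 0 0 = U 0 0 + W 0 0 by rewrite mxE.
have eB (U W : 'M[C]_1) : (U - W) 0 0 = U 0 0 - W 0 0 by rewrite !mxE.
have eZ a (U : 'M[C]_1) : (a *: U) 0 0 = a * U 0 0 by rewrite mxE.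
rewrite eB eZ !eD => h1 h2; have := addr_ge0 h1 h2; rewrite -[in X in _ -> X]subr_ge0.
by congr (_ <= _); ring.
Qed.
End Schur.

(** * The spectral density bounds the angle between components *)

Section Spectral.
Context {R : realType}.

Definition expi (x : R) : R[i] := Complex (cos x) (sin x).

Lemma expiB x y : expi (x - y) = expi x * (expi y)^*.
Proof.
apply/eqP; rewrite eq_complex ReM ImM Re_conj Im_conj /expi /= cosB sinB mulrN.
by rewrite opprK eqxx /= mulrN addrC eqxx.
Qed.

Lemma integrable_bounded_mul (h g : R -> R) : continuous h -> (forall x, `|h x| <= 1) ->
  lebesgue_measure.-integrable setT (EFin \o g) ->
  lebesgue_measure.-integrable setT (EFin \o (fun x => h x * g x)).
Proof.
move=> ch h1 ig.
have mh : measurable_fun [set: measurableTypeR R] (h : measurableTypeR R -> R).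
  exact: continuous_measurable_fun.
have bh : [bounded h x | x in [set: measurableTypeR R]].
  by exists 1; split=> // M M1 x _ /=; apply: le_trans (h1 x) (ltW M1).
exact: (integrableMr measurableT mh bh ig).
Qed.

Lemma cintegrable_expi (t : R) (g : R -> R[i]) : cintegrable lebesgue_measure g ->
  cintegrable lebesgue_measure (fun l => expi (l * t) * g l).
Proof.
move=> [g1 g2].
have cc : continuous (fun l : R => cos (l * t)).
  by move=> x; apply: continuous_comp; [exact: mulrr_continuous|exact: continuous_cos].
have cs : continuous (fun l : R => sin (l * t)).
  by move=> x; apply: continuous_comp; [exact: mulrr_continuous|exact: continuous_sin].
split.
- apply: eq_integrable (integrable_lin 1 (-1)
    (integrable_bounded_mul cc (fun x => cos_max _) g1)
    (integrable_bounded_mul cs (fun x => sin_max _) g2)) => // x _ /=.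
  by rewrite ReM mul1r mulN1r.
- apply: eq_integrable (integrable_lin 1 1
    (integrable_bounded_mul cc (fun x => cos_max _) g2)
    (integrable_bounded_mul cs (fun x => sin_max _) g1)) => // x _ /=.
  by rewrite ImM !mul1r.
Qed.

Context d (T : measurableType d) (P : probability T R).
Context (k : nat) (Y : 'I_k -> R -> T -> R[i]).
Hypothesis stat : weakly_stationary P Y.
Variable f : R -> 'M[R[i]]_k.
Hypothesis fY : is_spectral_density P Y f.

Lemma Y_sqint a t : Y a t \in sqint_pred P.
Proof. by apply/sqintE; case: stat. Qed.

Definition yL2 a t : L2 P := MkL2 (Y_sqint a t).

Local Notation dot := (L2form P).

Lemma cintegrable_fY (a b : 'I_k) (t : R) :
  cintegrable lebesgue_measure (fun l => expi (l * t) * f l a b).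
Proof. by apply: cintegrable_expi; case: (fY a b). Qed.

Lemma dot_yL2 a b (s t : R) : dot (yL2 a s) (yL2 b t) =
  cintegral lebesgue_measure (fun l => expi (l * s) * (expi (l * t))^* * f l a b).
Proof.
case: stat => _ _ /(_ a b (s - t) 0 t); rewrite subrK add0r => st.
rewrite /= /L2inner /= st (fY a b).2.
by congr cintegral; apply/funext => l; rewrite -expiB -mulrBr.
Qed.

(** The Fourier transform of a finite linear combination, as a row vector. *)
Definition transform (s : seq (R[i] * ('I_k * R))) (l : R) : 'rV[R[i]]_k :=
  \sum_(p <- s) (p.1 * expi (l * p.2.2)) *: delta_mx 0 p.2.1.

Definition qform (M : 'M[R[i]]_k) (v : 'rV_k) : R[i] := (v *m M *m v^t*) 0 0.

Lemma dot_suml (I : Type) (r : seq I) (F : I -> L2 P) z :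
  dot (\sum_(i <- r) F i) z = \sum_(i <- r) dot (F i) z.
Proof.
by elim: r => [|i r IH]; rewrite ?big_nil ?dot0l // !big_cons formDl IH.
Qed.

Lemma dot_sumr (I : Type) (r : seq I) (F : I -> L2 P) z :
  dot z (\sum_(i <- r) F i) = \sum_(i <- r) dot z (F i).
Proof.
by elim: r => [|i r IH]; rewrite ?big_nil ?dot0r // !big_cons dotDr IH.
Qed.

Lemma qform_transform s l : qform (f l) (transform s l) =
  \sum_(p <- s) \sum_(q <- s) p.1 * q.1^* *
     (expi (l * p.2.2) * (expi (l * q.2.2))^* * f l p.2.1 q.2.1).
Proof.
rewrite /qform /transform !mulmx_suml summxE; apply: eq_bigr => p _.
have -> : (\sum_(p <- s) (p.1 * expi (l * p.2.2)) *: delta_mx 0 p.2.1)^t* =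
    \sum_(q <- s) (q.1 * expi (l * q.2.2))^* *: delta_mx q.2.1 0 :> 'cV[R[i]]_k.
  rewrite linear_sum /= raddf_sum /=; apply: eq_bigr => q _.
  by rewrite linearZ /= map_mxZ trmx_delta map_delta_mx.
rewrite mulmx_sumr summxE; apply: eq_bigr => q _.
rewrite -!scalemxAl -scalemxAr -rowE -colE !mxE rmorphM /=; ring.
Qed.

Lemma cintegrable_qform s :
  cintegrable lebesgue_measure (fun l => qform (f l) (transform s l)).
Proof.
under eq_fun do rewrite qform_transform.
do 2 apply: cintegrable_sum => ?; apply: cintegrableZ.
by under eq_fun do rewrite -expiB -mulrBr; exact: cintegrable_fY.
Qed.

(** The spectral representation turns the norm into the integral of a quadratic
    form, which can be estimated frequency by frequency. *)
Lemma nsq_comb s : nsq dot (comb yL2 s) =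
  \int[lebesgue_measure]_l complex.Re (qform (f l) (transform s l)).
Proof.
have ci p q (c : R[i]) : cintegrable lebesgue_measure (fun l => c *
    (expi (l * p.2.2) * (expi (l * q.2.2))^* * f l p.2.1 q.2.1)).
  by apply: cintegrableZ; under eq_fun do rewrite -expiB -mulrBr; exact: cintegrable_fY.
suff -> : nsq dot (comb yL2 s) = complex.Re (cintegral lebesgue_measure
  (fun l => qform (f l) (transform s l))) by [].
congr complex.Re; rewrite /comb dot_suml.
under [in RHS]eq_fun do rewrite qform_transform.
rewrite cintegral_sum => [|p]; last by apply: cintegrable_sum.
apply: eq_bigr => p _; rewrite dot_sumr cintegral_sum //; apply: eq_bigr => q _.
rewrite formZl dotZr dot_yL2 mulrA cintegralZ //.
by under eq_fun do rewrite -expiB -mulrBr; exact: cintegrable_fY.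
Qed.

Hypothesis f_pos : forall l, posdefmx (f l).

Lemma transform_cat s1 s2 l : transform (s1 ++ s2) l = transform s1 l + transform s2 l.
Proof. by rewrite /transform big_cat. Qed.

Lemma transform_supp (A : {set 'I_k}) s l j : {in s, forall p, p.2.1 \in A} ->
  j \notin A -> transform s l 0 j = 0.
Proof.
move=> sA jA; rewrite /transform summxE big_seq big1 // => p /sA pA.
by rewrite !mxE eqxx /=; case: eqVneq => [jp|_]; [rewrite jp pA in jA|rewrite mulr0].
Qed.

Lemma comb_angle (A B : {set 'I_k}) (eps : R) s1 s2 : 0 <= eps ->
  {ae lebesgue_measure, forall l : R,
     possemidefmx ((Complex (1 - eps) 0)%:M
        - invsqrtmx (blockmx A A (f l)) *m blockmx A B (f l)
          *m invmx (blockmx B B (f l)) *m blockmx B A (f l)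
          *m invsqrtmx (blockmx A A (f l)))} ->
  {in s1, forall p, p.2.1 \in A} -> {in s2, forall p, p.2.1 \in B} ->
  eps * nsq dot (comb yL2 s1) <= nsq dot (comb yL2 s1 + comb yL2 s2).
Proof.
move=> e0 psd s1A s2B.
have -> : comb yL2 s1 + comb yL2 s2 = comb yL2 (s1 ++ s2) by rewrite /comb big_cat.
have i1 := (cintegrable_qform s1).1; have i2 := (cintegrable_qform (s1 ++ s2)).1.
have q0 s l : 0 <= complex.Re (qform (f l) (transform s l)).
  by have := posdefmx_ge0 (transform s l) (f_pos l); rewrite lecE => /andP[].
rewrite !nsq_comb -RintegralZl // /Rintegral fine_le //.
- by apply: integrable_fin_num => //; exact: (integrableZl measurableT eps i1).
- exact: integrable_fin_num.
apply: ae_ge0_le_integral => //.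
- by move=> l _; rewrite lee_fin mulr_ge0.
- exact: (measurable_int _ (integrableZl measurableT eps i1)).
- by move=> l _; rewrite lee_fin.
- exact: (measurable_int _ i2).
case: psd => N [mN N0 psdN]; exists N; split=> // l; apply: contra_notP => lN _.
have {}psd := contrapT (fun nh => lN (psdN l nh)).
rewrite lee_fin transform_cat.
have := schur_bound (f_pos l) (eps := eps%:C%C) (X := transform s1 l)
  (Z := transform s2 l) (A := A) (B := B).
rewrite (_ : 1 - eps%:C%C = Complex (1 - eps) 0); last first.
  by apply/eqP; rewrite eq_complex /= subrr !eqxx.
move=> h'; have h := h' psd => {h'}.
have := h (fun j => transform_supp l s1A) (fun j => transform_supp l s2B).
by rewrite lecE => /andP[_]; rewrite ReZ.
Qed.

Lemma space_angle (A : {set 'I_k}) (eps : R) x z : 0 <= eps ->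
  {ae lebesgue_measure, forall l : R,
     possemidefmx ((Complex (1 - eps) 0)%:M
        - invsqrtmx (blockmx A A (f l)) *m blockmx A (~: A) (f l)
          *m invmx (blockmx (~: A) (~: A) (f l)) *m blockmx (~: A) A (f l)
          *m invsqrtmx (blockmx A A (f l)))} ->
  space dot yL2 (always A) x -> space dot yL2 (always (~: A)) z ->
  eps * nsq dot x <= nsq dot (x + z).
Proof.
move=> e0 psd /space_comb hx /space_comb hz.
apply: (angle_closure e0 _ hx hz) => _ _ [s1 h1 ->] [s2 h2 ->].
exact: (comb_angle e0 psd h1 h2).
Qed.
End Spectral.

(** * Spaces of random variables and spaces of vectors *)

Section Bridge.
Context {R : realType} d (T : measurableType d) (P : probability T R).
Local Notation dot := (L2form P).

Lemma L2fun_sum (I : Type) (r : seq I) (c : I -> R[i]) (z : I -> L2 P) :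
  L2fun (\sum_(i <- r) c i *: z i) = (fun w => \sum_(i <- r) c i * L2fun (z i) w).
Proof.
elim: r => [|i r IH]; apply/funext => w; first by rewrite !big_nil.
by rewrite !big_cons -[in RHS](congr1 (fun g => g w) IH).
Qed.

Lemma L2dist_norm (x z : L2 P) : L2dist P (L2fun x) (L2fun z) = norm dot (x - z).
Proof. by []. Qed.

(** The projection chosen on functions and the one chosen on vectors differ by a
    null vector, so they define the same conditional orthogonality. *)
Lemma cond_orthE (L1 LB L3 : set (T -> R[i])) (K1 K2 K3 : set (L2 P)) :
  L1 `<=` sqint P -> LB `<=` sqint P -> L3 `<=` sqint P ->
  (forall x, L1 (L2fun x) <-> K1 x) -> (forall x, LB (L2fun x) <-> K2 x) ->
  (forall x, L3 (L2fun x) <-> K3 x) -> closed_subspace dot K3 ->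
  cond_orth P L1 LB L3 <-> corth dot K1 K2 K3.
Proof.
move=> s1 s2 s3 e1 e2 e3 cK.
have projE x : exists2 q, Defs.proj P L3 (L2fun x) = L2fun q & is_oproj dot K3 x q.
  have [Kp xp] := oprojP x cK.
  have ip : is_proj P L3 (L2fun x) (L2fun (oproj dot K3 x)).
    split; first exact/e3.
    move=> W LW; have /sqintE W2 := s3 _ LW; exact: (xp (MkL2 W2) ((e3 (MkL2 W2)).1 LW)).
  have : is_proj P L3 (L2fun x) (Defs.proj P L3 (L2fun x)) by apply: xgetPex; exact: ex_intro ip.
  move=> [LZ hZ]; have /sqintE Z2 := s3 _ LZ.
  exists (MkL2 Z2) => //; split; first exact/e3.
  by move=> w /e3; exact: hZ.
have key x y : inner P (L2fun x \- Defs.proj P L3 (L2fun x)) (L2fun y \- Defs.proj P L3 (L2fun y))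
    = ccov dot K3 x y.
  have [q -> xq] := projE x; have [q' -> yq'] := projE y.
  rewrite -[LHS]/(dot (x - q) (y - q')) dotBr (xq.2 q' yq'.1) subr0.
  rewrite /ccov -[x - q](subrKA (oproj dot K3 x)) [LHS]formDl.

  rewrite (@nsq_eq0_dot _ _ dot (oproj dot K3 x - q)) ?addr0 //.
  by apply: is_oproj_unique xq => //; exact: oprojP.
split=> [h x y /e1 Lx /e2 Ly|h X Z LX LZ]; first by rewrite -key; exact: h.
have /sqintE X2 := s1 _ LX; have /sqintE Z2 := s2 _ LZ.
by rewrite (key (MkL2 X2) (MkL2 Z2)) h //; [apply/e1|apply/e2].
Qed.

Context (k : nat) (Y : 'I_k -> R -> T -> R[i]).
Hypothesis stat : weakly_stationary P Y.
Local Notation y := (yL2 stat).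

Definition during (A : {set 'I_k}) (s t : \bar R) : set ('I_k * R) :=
  [set j | j.1 \in A /\ (s <= j.2%:E <= t)%E].

Lemma lin_spaceE (A : {set 'I_k}) s t x :
  lin_space P Y A s t (L2fun x) <-> space dot y (during A s t) x.
Proof.
split=> [[_ h]|hx].
  apply: (csub_lim (closed_space _ _ _)) => e e0.
  have se : 0 < Num.sqrt e by rewrite sqrtr_gt0.
  have [Z [n [c [z [hz ->]]]] dZ] := h _ se.
  have /choice[g gP] : forall i, exists j, during A s t j /\ z i = L2fun (y j.1 j.2).
    by move=> i; have [a [u [aA su ->]]] := hz i; exists (a, u).
  exists (\sum_(i < n) c i *: y (g i).1 (g i).2).
    have := @comb_space _ _ dot _ y (during A s t) [seq (c i, g i) | i <- enum 'I_n].
    rewrite /comb big_map big_enum; apply => _ /mapP[i _ ->]; exact: (gP i).1.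
  have Ze : (fun w => \sum_(i < n) c i * z i w) = L2fun (\sum_(i < n) c i *: y (g i).1 (g i).2).
    by rewrite L2fun_sum; apply/funext => w; apply: eq_bigr => i _; rewrite (gP i).2.
  by move: dZ; rewrite Ze L2dist_norm /norm ltr_sqrt.
split; first exact: L2_sqint.
move=> e e0; have e20 : 0 < e ^+ 2 by rewrite exprn_gt0.
have [_ [r hr ->] hz] := space_comb hx e20.
exists (L2fun (comb y r)).
  exists (size r), (fun i => (tnth (in_tuple r) i).1).
  exists (fun i => let p := (tnth (in_tuple r) i).2 in Y p.1 p.2); split.
    move=> i; have [pA ps] := hr _ (mem_tnth i (in_tuple r)).
    by exists (tnth (in_tuple r) i).2.1, (tnth (in_tuple r) i).2.2.
  rewrite /comb L2fun_sum; apply/funext => w; rewrite (big_tnth _ _ r).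
  by apply: eq_bigr.
by rewrite L2dist_norm /norm -[ltRHS]ger0_norm ?ltW // -sqrtr_sqr ltr_sqrt.
Qed.

Lemma lin_space_sqint (A : {set 'I_k}) s t : lin_space P Y A s t `<=` sqint P.
Proof. by move=> X []. Qed.

Lemma cond_orth_lin_space (A B C : {set 'I_k}) s1 t1 s2 t2 s3 t3 :
  cond_orth P (lin_space P Y A s1 t1) (lin_space P Y B s2 t2)
    (lin_space P Y C s3 t3) <->
  corth dot (space dot y (during A s1 t1)) (space dot y (during B s2 t2))
    (space dot y (during C s3 t3)).
Proof.
apply: cond_orthE; try exact: lin_space_sqint; try exact: lin_spaceE.
exact: closed_space.
Qed.

Lemma during_past (A : {set 'I_k}) t : during A -oo%E t%:E = past A t.
Proof. by apply/seteqP; split=> -[a u]; rewrite /during /past /= leNye lee_fin. Qed.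

Lemma during_window (A : {set 'I_k}) t : during A t%:E (t + 1)%:E = window A t.
Proof. by apply/seteqP; split=> -[a u]; rewrite /during /window /= !lee_fin. Qed.

Lemma during_always (A : {set 'I_k}) : during A -oo%E +oo%E = always A.
Proof.
by apply/seteqP; split=> -[a u]; rewrite /during /always /= leNye leey => // -[].
Qed.

Lemma noncausal_noncausal_at a b :
  noncausal P Y [set a]%SET [set b]%SET [set: 'I_k]%SET -> noncausal_at dot y a b.
Proof.
move=> h t u v tu vt; have /cond_orth_lin_space := h t.
rewrite during_window !during_past finset.setTD; apply.
- by apply: mem_space; split=> //=; rewrite inE.
- by apply: mem_space; split=> //=; rewrite inE.
Qed.

Lemma uncorrelated_uncorrelated_at a b :
  uncorrelated P Y [set a]%SET [set b]%SET [set: 'I_k]%SET -> uncorrelated_at dot y a b.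
Proof.
move=> h t u v tu tv; have /cond_orth_lin_space := h t.
rewrite !during_window during_past; apply.
- by apply: mem_space; split=> //=; rewrite inE.
- by apply: mem_space; split=> //=; rewrite inE.
Qed.

Lemma nsq_ae0 (x : L2 P) : {ae P, forall w, L2fun x w = 0} -> nsq dot x = 0.
Proof.
move=> [N [mN N0 xN]]; rewrite /nsq Re_L2inner /Rintegral.
have [xr xi] := L2_sqint x.
have i2 : P.-integrable setT (EFin \o (fun w =>
    complex.Re (L2fun x w) ^+ 2 + complex.Im (L2fun x w) ^+ 2)).
  apply: eq_integrable (integrable_lin 1 1 (Lfun2_integrable_sqr xr)
    (Lfun2_integrable_sqr xi)) => // w _ /=; by rewrite !mul1r.
rewrite (negligible_integral mN measurableT i2 N0) integral0_eq // => w [_ wN].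
have xw : L2fun x w = 0 by apply: contrapT => h; apply: wN; exact: xN.
by rewrite /= xw expr0n /= addr0.
Qed.

End Bridge.

(** * The global Markov property *)

Theorem theorem5p15 (R : realType) (d : measure_display) (T : measurableType d)
    (P : probability T R) (k : nat) (Y : 'I_k -> R -> T -> R[i])
    (Y_stationary : weakly_stationary P Y)
    (Y_mean_zero : mean_zero P Y)
    (Y_continuous : ms_continuous P Y)
    (Y_spectral : spectral_density_condition P Y)
    (Y_nondeterministic : purely_nondeterministic P Y) :
  global_AMP_Markov P Y (orthogonality_graph P Y).
Proof.
move=> A B C AB AC BC sep.
have [f [fY fpos [eps [/andP[eps0 _] bound]]]] := Y_spectral.
pose y := yL2 Y_stationary; pose G := orthogonality_graph P Y.
have angle (W : {set 'I_k}) x z : space (L2form P) y (always W) x ->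
    space (L2form P) y (always (~: W)) z ->
    eps * nsq (L2form P) x <= nsq (L2form P) (x + z).
  apply: (space_angle fY fpos (ltW eps0)); apply: bound.
  by rewrite finset.disjoints_subset finset.setCK.
have remote x : (forall t, space (L2form P) y (past [set: 'I_k]%SET t) x) ->
    nsq (L2form P) x = 0.
  move=> xt; apply: nsq_ae0.
  suff : zero_space P (L2fun x) by case.
  rewrite -Y_nondeterministic => t _.
  by apply/(lin_spaceE Y_stationary); rewrite during_past.
have nc a b : a != b -> ~ directed G a b -> noncausal_at (L2form P) y a b.
  move=> ab nab; apply: noncausal_noncausal_at; apply: contrapT => h.
  by apply: nab.
have uc a b : a != b -> ~ dashed G a b -> uncorrelated_at (L2form P) y a b.
  move=> ab nab; apply: uncorrelated_uncorrelated_at; apply: contrapT => h.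
  by apply: nab.
apply/(cond_orth_lin_space Y_stationary); rewrite !during_always.
have main : corth (L2form P) (space (L2form P) y (always (sideA G A B C)))
    (space (L2form P) y (always (sideB G A B C))) (space (L2form P) y (always C)).
  apply: (separated_always eps0 angle (M := sideM G A B C) (N := sideN G A B C)) => //.
  - exact: sub_sideA_sideM.
  - exact: sideB_sideN.
  - exact: C_subset.
  - exact: sideM_subset.
  - exact: sideN_subset.
  - move=> a b aAC bM; apply: nc; last exact: no_edge_into_M bM.
    by apply: contraNneq aAC => ->; exact: (fintype.subsetP (sideM_subset _ _ _ _)).
  - move=> a b aBC bN; apply: nc; last exact: no_edge_into_N bN.
    by apply: contraNneq aBC => ->; exact: (fintype.subsetP (sideN_subset _ _ _ _)).
  - move=> a b aM bN; apply: uc; last exact: no_dashed_MN aM bN.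
    by apply: contraTneq bN => <-; rewrite finset.in_setD aM.
have /fintype.subsetP subA : A \subset sideA G A B C by exact: sub_sideA.
have /fintype.subsetP subB : B \subset sideB G A B C by exact: sub_sideB.
move=> x z xA zB; apply: main.
- by apply: space_mono xA => j; exact: subA.
- by apply: space_mono zB => j; exact: subB.
Qed.
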